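(* Let $q$ be a unimodal and symmetric probability density on $\mathbb R$ with respect to the Lebesgue measure and let $F\subset\mathcal F$ be a model for $f$ which is VC-subgraph of index $\overline V(F)$. There exist a universal constant $C>0$ and a $\rho$-estimator $\widehat s=q_{\widehat f}$ of $s=p_f$ (based on a countable and dense subset of $\overline S_F$) such that for all $\xi>0$, with probability at least $1-e^{-\xi}$, $$\begin{aligned}Ch^2(p_f,q_{\widehat f})&\le\inf_{g\in F}h^2(p_f,q_g)+\frac{\overline V(F)}n\Big[1+\log_+\Big(\frac n{\overline V(F)}\Big)\Big]+\frac\xi n\\&\le2h^2(p,q)+2\inf_{g\in F}h^2(p_f,p_g)+\frac{\overline V(F)}n\Big[1+\log_+\Big(\frac n{\overline V(F)}\Big)\Big]+\frac\xi n.\end{aligned}$$ If, in particular, $p=q$, then for all $\xi>0$, $$\mathbb P_{\mathbf s}\Big[C\ell(f,\widehat f)\le\inf_{g\in F}\ell(f,g)+\frac{\overline V(F)}n\Big[1+\log_+\Big(\frac n{\overline V(F)}\Big)\Big]+\frac\xi n\Big]\ge1-e^{-\xi}.$$ If, moreover, $p=q$ is of order $\alpha\in(-1,1]$ with constants $A_p\ge a_p>0$ and $\max\{\sup_{g\in F}\|g\|_\infty,\|f\|_\infty\}\le b<+\infty$, then $$\mathbb P_{\mathbf s}\Big[C'\|f-\widehat f\|_{1+\alpha,\nu}^{1+\alpha}\le\inf_{g\in F}\|f-g\|_{1+\alpha,\nu}^{1+\alpha}+\frac{\overline V(F)}n\Big[1+\log_+\Big(\frac n{\overline V(F)}\Big)\Big]+\frac\xi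 n\Big]\ge1-e^{-\xi}$$ for all $\xi>0$ and some constant $C'$ depending only on $A_p,a_p,b$ and $\alpha$.
   Context: Random design regression. $n\ge3$; $X_i=(W_i,Y_i)$, $1\le i\le n$, are i.i.d. copies of $(W,Y)$ with values in $\mathcal W\times\mathbb R$ ($\mathcal W$ a measurable space), $Y=f(W)+\varepsilon$, where $f$ belongs to a set $\mathcal F$ of measurable functions from $\mathcal W$ to $\mathbb R$, and $\varepsilon$ is independent of $W$ with density $p$ with respect to the Lebesgue measure $\mu$; $W$ has (possibly unknown) distribution $\nu$. For a density $q$ on $\mathbb R$ and a function $g$, $q_g(w,y)=q(y-g(w))$, a density with respect to $\nu\otimes\mu$. The density of $(W,Y)$ is $s=p_f$, $\mathbf s=(s,\dots,s)$, and $\mathbb P_{\mathbf s}$ is the corresponding probability. For densities $u,v$ with respect to a measure $\lambda$, $h^2(u,v)=\frac12\int(\sqrt u-\sqrt v)^2d\lambda$ and $\rho(u,v)=\int\sqrt{uv}\,d\lambda$ ($\lambda=\nu\otimes\mu$ for $h(p_f,q_g)$, $\lambda=\mu$ for $h(p,q)$). $\ell(g,g')=h^2(p_g,p_{g'})=\int_{\mathcal W}h^2(p(\cdot-g(w)),p(\cdot-g'(w)))\,d\nu(w)$. $\|g\|_{1+\alpha,\nu}^{1+\alpha}=\int_{\mathcal W}|g|^{1+\alpha}d\nu$; $\|\cdot\|_\infty$ is the sup norm. $\overline S_F=\{q_g:g\in F\}$ (a density $t$ being identified with $(t,\dots,t)$) is assumed to be a model, i.e. nonempty and separable for $h$. $\log_+x=\max\{\log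 x,0\}$. Unimodal: non-decreasing then non-increasing. A density $q$ on $\mathbb R$ is of order $\alpha\in(-1,1]$ if for some constants $A_q\ge a_q>0$ and all $u,v\in\mathbb R$, $a_q[|u-v|^{1+\alpha}\wedge A_q^{-1}]\le h^2(q(\cdot-u),q(\cdot-v))\le A_q[|u-v|^{1+\alpha}\wedge A_q^{-1}]$. VC-subgraph: a class of functions on a set $\Xi$ is VC-subgraph with index $\overline V$ if the class of its subgraphs $\{(x,u)\in\Xi\times\mathbb R:f(x)>u\}$ has finite VC-index $\overline V$, i.e. $\overline V$ is the smallest integer $m$ such that no set of $m$ points is shattered. $\rho$-estimators. $\boldsymbol X=(X_1,\dots,X_n)$, $\psi(u)=\frac{u-1}{\sqrt{1+u^2}}$, $\psi(+\infty)=1$, $\kappa=357$; conventions $0/0=1$, $x/0=+\infty$ for $x>0$. For densities $t,t'$ with respect to $\nu\otimes\mu$ and $r=(t+t')/2$, $\mathbf T(\boldsymbol X,t,t')=\frac n2[\rho(t',r)-\rho(t,r)]+\frac1{\sqrt2}\sum_{i=1}^n\psi(\sqrt{t'/t}(X_i))$ (the first term vanishes for $t=q_g,t'=q_{g'}$ with $q$ symmetric, so that the procedure does not involve $\nu$). For a countable identifiable set $S$ of densities (distinct elements are at positive Hellinger distance), $\boldsymbol\Upsilon(S,t)=\sup_{t'\in S}\mathbf T(\boldsymbol X,t,t')$, $\mathcal E(\boldsymbol X,S)=\{t\in S:\boldsymbol\Upsilon(S,t)\le\inf_{u\in S}\boldsymbol\Upsilon(S,u)+\kappa/10\}$; a $\rho$-estimator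 based on $S$ is any measurably chosen element of the Hellinger closure of $\mathcal E(\boldsymbol X,S)$. *)

(* Defs.v *)
From HB Require Import structures.
From mathcomp Require Import all_boot all_order all_algebra.
From mathcomp Require Import all_classical all_reals all_analysis.

Set Implicit Arguments.
Unset Strict Implicit.
Unset Printing Implicit Defensive.

Import Order.TTheory GRing.Theory Num.Theory.
Import numFieldNormedType.Exports.

Local Open Scope classical_set_scope.
Local Open Scope ring_scope.

Section Hellinger.
Context {R : realType} {d : measure_display} {T : measurableType d}.
Variable m : {measure set T -> \bar R}.
Implicit Types (u v t : T -> R) (A S O : set (T -> R)).

Definition is_density u : Prop :=
  [/\ measurable_fun setT u, (forall x, 0 <= u x) &
      (\int[m]_x (u x)%:E = 1)%E].

Definition hellinger2 u v : R :=
  2^-1 * Rintegral m setT (fun x => (Num.sqrt (u x) - Num.sqrt (v x)) ^+ 2).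

Definition hellinger u v : R := Num.sqrt (hellinger2 u v).

Definition affinity u v : R := Rintegral m setT (fun x => Num.sqrt (u x * v x)).

Definition hellinger_closure A : set (T -> R) :=
  [set t | is_density t /\
           forall e, 0 < e -> exists2 u, A u & hellinger t u < e].

Definition countable_dense_subset A S : Prop :=
  [/\ countable A, A `<=` S & S `<=` hellinger_closure A].

Definition is_model S : Prop :=
  S !=set0 /\ exists A, countable_dense_subset A S.

Definition identifiable S : Prop :=
  forall t t', S t -> S t' -> t <> t' -> 0 < hellinger t t'.

Definition hellinger_open O : Prop :=
  O `<=` is_density /\
  forall t, O t ->
    exists2 e, 0 < e & forall u, is_density u -> hellinger t u < e -> O u.

(* Borel measurability, the densities carrying the topology of the Hellinger
   pseudo-distance. *)
Definition hellinger_measurable {d' : measure_display} {E : measurableType d'}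
    (s : E -> T -> R) : Prop :=
  forall O, hellinger_open O -> measurable (s @^-1` O).

End Hellinger.

Section RhoEstimators.
Context {R : realType} {d : measure_display} {T : measurableType d}.
Variable m : {measure set T -> \bar R}.
Implicit Types (t : T -> R) (S : set (T -> R)).

(* The value at -oo is never used: psi is only evaluated on [0, +oo]. *)
Definition psi (u : \bar R) : R :=
  match u with
  | r%:E%E => (r - 1) / Num.sqrt (1 + r ^+ 2)
  | +oo%E => 1
  | -oo%E => 0
  end.

(* The quotient a / b of nonnegative reals, with 0/0 = 1 and a/0 = +oo if
   0 < a. *)
Definition density_ratio (a b : R) : \bar R :=
  if b == 0 then (if a == 0 then 1%E else +oo%E) else (a / b)%:E.

Definition rho_test (n : nat) (x : n.-tuple T) t t' : R :=
  let r y := (t y + t' y) / 2 in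
  n%:R / 2 * (affinity m t' r - affinity m t r)
  + (Num.sqrt 2)^-1 *
    \sum_(i < n) psi (er_map (@Num.sqrt R)
      (density_ratio (t' (tnth x i)) (t (tnth x i)))).

Definition kappa : R := 357.

Definition rho_sup (n : nat) (x : n.-tuple T) S t : \bar R :=
  ereal_sup [set (rho_test x t t')%:E | t' in S].

Definition rho_candidates (n : nat) (x : n.-tuple T) S : set (T -> R) :=
  [set t | S t /\
    (rho_sup x S t
       <= ereal_inf [set rho_sup x S u | u in S] + (kappa / 10)%:E)%E].

Definition is_rho_estimator (n : nat) S (shat : n.-tuple T -> T -> R) : Prop :=
  [/\ countable S, S `<=` is_density m, identifiable m S,
      hellinger_measurable m shat &
      forall x, hellinger_closure m (rho_candidates x S) (shat x)].

End RhoEstimators.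

Section VC.

Definition shatters {T : Type} (K : set (set T)) (A : set T) : Prop :=
  forall B, B `<=` A -> exists2 D, K D & A `&` D = B.

Definition shatters_card {T : Type} (K : set (set T)) (m : nat) : Prop :=
  exists2 A : set T, (A #= `I_m)%card & shatters K A.

Definition has_vc_index {T : Type} (K : set (set T)) (V : nat) : Prop :=
  ~ shatters_card K V /\ forall m, ~ shatters_card K m -> (V <= m)%N.

Definition subgraph {R : realType} {T : Type} (g : T -> R) : set (T * R) :=
  [set z | g z.1 > z.2].

Definition vc_subgraph {R : realType} {T : Type} (F : set (T -> R)) (V : nat) :
    Prop :=
  has_vc_index [set subgraph g | g in F] V.

End VC.

Section RealDensities.
Context {R : realType}.
Implicit Types (q : R -> R).

(* The value of q at its mode a is unconstrained: a density that blows up at its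
   mode (as those of order alpha < 0) has no meaningful real value there. *)
Definition unimodal q : Prop :=
  exists a : R,
    (forall x y, x <= y -> y < a -> q x <= q y) /\
    (forall x y, a < x -> x <= y -> q y <= q x).

Definition even_fun q : Prop := forall x, q (- x) = q x.

Definition has_order q (alpha A a : R) : Prop :=
  [/\ -1 < alpha <= 1, 0 < a, a <= A &
    forall u v,
      let D := Num.min (`|u - v| `^ (1 + alpha)) A^-1 in
      a * D
        <= hellinger2 lebesgue_measure (fun y => q (y - u)) (fun y => q (y - v))
        <= A * D].

Definition logp (x : R) : R := Num.max (ln x) 0.

Definition sup_norm {T : Type} (g : T -> R) : \bar R :=
  ereal_sup [set `|g w|%:E | w in setT].

End RealDensities.

Section Regression.
Context {R : realType} {d : measure_display} {W : measurableType d}.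
Variable nu : probability W R.
Implicit Types (p q : R -> R) (f g : W -> R).

(* The real line is measurableTypeR R, the domain of lebesgue_measure. *)
Definition design_measure : {measure set (W * measurableTypeR R) -> \bar R} :=
  (nu \x lebesgue_measure)%E.

Definition translate q g : W * measurableTypeR R -> R :=
  fun z => q (z.2 - g z.1).

Definition loss p g g' : R :=
  hellinger2 design_measure (translate p g) (translate p g').

(* The power ||g||_{r, nu}^r of the L^r(nu) (quasi-)norm. *)
Definition Lnorm_pow (r : R) g : R := Rintegral nu setT (fun w => `|g w| `^ r).

Definition mutually_independent {dO dT : measure_display}
    {Omega : measurableType dO} {T : measurableType dT}
    (P : probability Omega R) (n : nat) (X : 'I_n -> Omega -> T) : Prop :=
  forall (J : {set 'I_n}) (A : 'I_n -> set T), (forall i, measurable (A i)) ->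
    P (\bigcap_(i in [set i | i \in J]) (X i @^-1` A i))
    = (\prod_(i in J) P (X i @^-1` A i))%E.

(* X i = (W_i, Y_i) are independent, W_i has distribution nu, and the errors
   Y_i - f(W_i) are independent of W_i with density p. *)
Definition regression_sample {dO : measure_display} {Omega : measurableType dO}
    (P : probability Omega R) p f (n : nat)
    (X : 'I_n -> {RV P >-> (W * measurableTypeR R)%type}) : Prop :=
  let design i := fun omega => (X i omega).1 in
  let error i := fun omega => (X i omega).2 - f (X i omega).1 in
  [/\ mutually_independent P (fun i => X i : Omega -> W * measurableTypeR R),
      (forall i A, measurable A -> P (design i @^-1` A) = nu A),
      (forall i B, measurable B ->
         P (error i @^-1` B) = (\int[lebesgue_measure]_(y in B) (p y)%:E)%E) &
      (forall i A B, measurable A -> measurable B ->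
         P (design i @^-1` A `&` error i @^-1` B)
         = (P (design i @^-1` A) * P (error i @^-1` B))%E)].

Definition sample {Omega : Type} (n : nat)
    (X : 'I_n -> Omega -> W * measurableTypeR R) (omega : Omega) : n.-tuple (W * measurableTypeR R) :=
  [tuple X i omega | i < n].

(* The measurability of E is included because P is unconstrained on
   non-measurable sets. *)
Definition prob_at_least {dO : measure_display} {Omega : measurableType dO}
    (P : probability Omega R) (E : set Omega) (c : R) : Prop :=
  measurable E /\ (c%:E <= P E)%E.

Definition risk_term (n V : nat) (xi : R) : R :=
  V%:R / n%:R * (1 + logp (n%:R / V%:R)) + xi / n%:R.

End Regression.

(* Main.v *)
Require Import Defs.
From HB Require Import structures.
From mathcomp Require Import all_boot all_order all_algebra.
From mathcomp Require Import all_classical all_reals all_analysis.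
From mathcomp Require Import measurable_realfun ring lra zify.
Import Order.TTheory GRing.Theory Num.Theory.
Import numFieldNormedType.Exports.
Local Open Scope classical_set_scope.
Local Open Scope ring_scope.

(* For densities t, t' the statistic of the test of t against t' is, up to a
   deterministic term, the sum of phi(X_i) with
   phi = (sqrt t' - sqrt t) / sqrt (t + t') in [-1, 1]. Since it is antisymmetric
   in (t, t'), only the tests against one fixed approximation t of the true
   density s matter, and phi is then a monotone function of t'. The mean of
   phi + phi^2 / 100 is controlled by h^2(s, t) and -h^2(s, t').

   The sum of phi - E (phi + phi^2 / 100) over the model is bounded from above
   with an exponential moment: Jensen's inequality introduces a second,
   independent sample; exchanging the i-th observations of the two samples leaves
   the law unchanged and the averaged exponential is at most 1. On the 2n
   observations t' runs over translates of a unimodal density by functions of a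
   VC-subgraph class: at precision V / n, the values of phi are determined by
   O(n^2 / V) comparisons of the functions with constants, hence by the
   Sauer-Shelah lemma there are at most exp (O(V (1 + log (n / V)))) of them. The
   union bound over them is the complexity term. *)

(** * Shattering and VC classes *)

(** The rate V / n, and not its square root, requires the variance of phi to be paid by the drift.
    Under s the mean of phi^2 is at most a constant times h^2(s, t) + h^2(s, t'), and the drift
    contains a negative multiple of h^2(s, t'). A small multiple of phi^2 can thus be carried along;
    its weight 1/100 is set by this balance. This replaces a localization on Hellinger balls. The
    law of the sample enters only after the estimator is fixed. The approximation t depends on s but
    is a member of the countable set S, so a deviation bound for this single t, uniform over t' in
    S, also covers the random choice made by the estimator. The estimator is a candidate in S
    itself, of least index in an enumeration, and not a mere limit of candidates. Hence it is q_g
    for some g in F and takes countably many values, which settles the measurability questions. When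
    V > n the bound is trivial, since h^2 is at most 1. *)

Definition shattered {T : finType} (A : {set {set T}}) : {set {set T}} :=
  [set J : {set T} | [forall B : {set T}, (B \subset J) ==>
     [exists D : {set T}, (D \in A) && (D :&: J == B)]]]%SET.

Lemma shatteredP {T : finType} (A : {set {set T}}) (J : {set T}) :
  reflect (forall B : {set T}, B \subset J ->
             exists2 D : {set T}, D \in A & (D :&: J)%SET = B)
          (J \in shattered A).
Proof.
rewrite inE; apply: (iffP forallP) => [H B BJ|H B].
  by have /implyP/(_ BJ)/existsP[D /andP[DA /eqP]] := H B; exists D.
apply/implyP => /H[D DA DJ]; apply/existsP; exists D; rewrite DA.
exact/eqP.
Qed.

Lemma shatteredS {T : finType} (A A' : {set {set T}}) :
  A \subset A' -> shattered A \subset shattered A'.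
Proof.
move=> /fintype.subsetP AA'; apply/fintype.subsetP => J /shatteredP sJ.
by apply/shatteredP => B /sJ[D /AA' DA' <-]; exists D.
Qed.

(* Pajor's strengthening of the Sauer-Shelah lemma. *)
Lemma card_le_shattered {T : finType} (A : {set {set T}}) :
  (#|A| <= #|shattered A|)%N.
Proof.
have [k] := ubnP #|A|; elim: k A => // k IH A; rewrite ltnS => Ak.
have [A1|] := leqP #|A| 1.
  have [->|/set0Pn[D DA]] := eqVneq A finset.set0; first by rewrite cards0.
  apply: (leq_trans A1); rewrite card_gt0; apply/set0Pn; exists finset.set0.
  apply/shatteredP => B; rewrite finset.subset0 => /eqP->.
  by exists D => //; rewrite finset.setI0.
move=> /card_gt1P[D1 [D2 [D1A D2A]]].
(* An element separating two members of [A] makes both halves of [A] nonempty, so that the induction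
   applies to each of them. *)
wlog [x xD1 xD2] : D1 D2 D1A D2A / exists2 x, x \in D1 & x \notin D2.
  move=> wl D12; have : ~~ (D1 \subset D2) || ~~ (D2 \subset D1).
    by rewrite -negb_and -finset.eqEsubset.
  case/orP => /subsetPn[x x1 x2].
    by apply: (wl D1 D2) => //; exists x.
  by apply: (wl D2 D1) => //; [exists x|rewrite eq_sym].
move=> _.
pose Ax := [set D in A | x \in D]%SET; pose Ay := [set D in A | x \notin D]%SET.
have AE : #|A| = (#|Ax| + #|Ay|)%N.
  rewrite -(cardsID [set D : {set T} | x \in D]%SET A); congr (_ + _)%N;
    by apply: eq_card => D; rewrite !inE // andbC.
have Ax_gt0 : (0 < #|Ax|)%N.
  by rewrite card_gt0; apply/set0Pn; exists D1; rewrite inE D1A.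
have Ay_gt0 : (0 < #|Ay|)%N.
  by rewrite card_gt0; apply/set0Pn; exists D2; rewrite inE D2A.
have IHx : (#|Ax| <= #|shattered Ax|)%N.
  by apply: IH; apply: leq_trans Ak; rewrite AE -[X in (X < _)%N]addn0 ltn_add2l.
have IHy : (#|Ay| <= #|shattered Ay|)%N.
  by apply: IH; apply: leq_trans Ak; rewrite AE -[X in (X < _)%N]add0n ltn_add2r.
have xNx J : J \in shattered Ax -> x \notin J.
  move=> /shatteredP /(_ _ (finset.sub0set J)) [D]; rewrite inE => /andP[_ xD] DJ.
  by apply/negP => xJ; move/setP/(_ x): DJ; rewrite !inE xD xJ.
have xNy J : J \in shattered Ay -> x \notin J.
  move=> /shatteredP /(_ _ (fintype.subxx J)) [D]; rewrite inE => /andP[_ xD] DJ.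
  by apply/negP => xJ; move/setP/(_ x): DJ; rewrite !inE xJ andbT (negPf xD).
pose U := (shattered Ax :|: shattered Ay)%SET.
pose I := (shattered Ax :&: shattered Ay)%SET.
rewrite AE; apply: (leq_trans (leq_add IHx IHy)).
rewrite -cardsUI.
(* A set shattered by both halves is counted twice in the sum. Adjoining [x] to it gives a second
   set shattered by [A], outside [U], whose members avoid [x]. *)
pose I' := [set (x |: J)%SET | J : {set T} in I]%SET.
have <- : #|I'| = #|I|.
  apply: card_in_imset => J J'; rewrite !finset.in_setI => /andP[/xNx xJ _] /andP[/xNx xJ' _].
  by move=> JJ'; rewrite -(setU1K xJ) JJ' setU1K.
have UI' : (U :&: I' = finset.set0)%SET.
  apply/setP => J; rewrite finset.in_setI finset.in_setU finset.in_set0; apply/negbTE/negP.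
  move=> /andP[JU /imsetP[J' J'I JE]].
  have : x \notin J by case/orP: JU => [/xNx|/xNy].
  by rewrite JE !inE eqxx.
have -> : (#|U| + #|I'|)%N = #|U :|: I'|.
  by rewrite cardsU UI' cards0 subn0.
apply/subset_leq_card/fintype.subsetP => J; rewrite finset.in_setU => /orP[|].
  rewrite finset.in_setU => /orP[|]; apply/fintype.subsetP/shatteredS/fintype.subsetP;
    by move=> D; rewrite inE => /andP[].
move=> /imsetP[J' + ->]; rewrite finset.in_setI => /andP[Jx Jy].
have xJ' := xNx _ Jx.
apply/shatteredP => B BJ.
have BJ' : (B :\ x)%SET \subset J'.
  by rewrite finset.subDset.
have key (D : {set T}) : (x \in D) = (x \in B) -> (D :&: J')%SET = (B :\ x)%SET ->
    (D :&: (x |: J'))%SET = B.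
  move=> xDB DB; apply/setP => y; move/setP/(_ y): DB; rewrite !inE.
  have [->|yx] /= := eqVneq y x; first by rewrite andbT.
  by move=> ->.
have [xB|xB] := boolP (x \in B).
  move/shatteredP : Jx => /(_ _ BJ')[D]; rewrite inE => /andP[DA xD] DJ.
  by exists D => //; apply: key; rewrite ?xD ?xB.
move/shatteredP : Jy => /(_ _ BJ')[D]; rewrite inE => /andP[DA xD] DJ.
by exists D => //; apply: key; rewrite ?(negPf xD) ?(negPf xB).
Qed.

Lemma card_le_sum_bin {T : finType} (A : {set {set T}}) (V : nat) :
  (forall J, J \in shattered A -> (#|J| < V)%N) ->
  (#|A| <= \sum_(j < V) 'C(#|T|, j))%N.
Proof.
move=> AV; apply: (leq_trans (card_le_shattered A)).
have -> : (\sum_(j < V) 'C(#|T|, j) =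
    \sum_(j < V) #|[set J : {set T} | #|J| == j]%SET|)%N.
  by apply: eq_bigr => j _; rewrite card_draws.
apply: (@leq_trans #|(\bigcup_(j < V) [set J : {set T} | #|J| == j])%SET|).
  apply/subset_leq_card/fintype.subsetP => J /AV JV.
  by apply/finset.bigcupP; exists (Ordinal JV) => //; rewrite inE.
elim/big_ind2 : _ => [|a b c d ab cd|//]; first by rewrite cards0.
by rewrite cardsU (leq_trans (leq_subr _ _))// leq_add.
Qed.

(** With [x = V / M <= 1], multiplying the sum by [x ^+ V] lowers it below the binomial expansion of
    [(1 + x) ^+ M], itself at most [expR V]. *)
Lemma sum_bin_le {R : realType} (M V : nat) : (0 < V)%N -> (V <= M)%N ->
  (\sum_(j < V) 'C(M, j))%:R <= (expR 1 * (M%:R / V%:R)) ^+ V :> R.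
Proof.
move=> V0 VM.
have V0' : (0 : R) < V%:R by rewrite ltr0n.
have M0' : (0 : R) < M%:R by rewrite ltr0n (leq_trans V0).
pose x : R := V%:R / M%:R.
have x0 : 0 < x by rewrite divr_gt0.
have x1 : x <= 1 by rewrite ler_pdivrMr// mul1r ler_nat.
have -> : M%:R / V%:R = x^-1 by rewrite /x invf_div.
rewrite exprMn exprVn ler_pdivlMr ?exprn_gt0//.
apply: (@le_trans _ _ ((1 + x) ^+ M)).
  rewrite exprDn natr_sum mulr_suml.
  have VM1 : (V <= M.+1)%N by rewrite (leq_trans VM).
  rewrite (big_ord_widen _ (fun j => ('C(M, j))%:R * x ^+ V) VM1).
  rewrite big_mkcond /=; apply: ler_sum => j _; rewrite expr1n mul1r.
  case: ifP => jV; last by rewrite mulrn_wge0// exprn_ge0// ltW.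
  rewrite mulr_natl ler_wMn2r// ler_wiXn2l ?(ltnW jV)//; exact: ltW.
rewrite -expRM_natl mulr1.
have -> : expR V%:R = expR x ^+ M.
  by rewrite -expRM_natl /x mulrC divfK// gt_eqF.
by apply: lerXn2r; rewrite ?nnegrE ?expR_ge0 ?expR_ge1Dx// addr_ge0// ltW.
Qed.

Lemma vc_card_patterns {R : realType} {W : Type} (F : set (W -> R)) (V m : nat)
    (I : finType) (w : I -> W) (c : I -> R) (g : 'I_m -> W -> R) :
  vc_subgraph F V -> (forall k, F (g k)) ->
  (#|[set [set i | (c i < g k (w i))%R] | k : 'I_m]%SET| <= \sum_(j < V) 'C(#|I|, j))%N.
Proof.
move=> [FV _] Fg; pose pat k := [set i | c i < g k (w i)]%SET.
rewrite -/pat; apply: card_le_sum_bin => J /shatteredP sJ.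
rewrite ltnNge; apply/negP => VJ; apply: FV.
have [J' J'J /eqP J'V] : exists2 J' : {set I}, J' \subset J & #|J'| == V.
  have := VJ; rewrite -(bin_gt0) -cards_draws card_gt0 => /set0Pn[J'].
  by rewrite inE => /andP[? ?]; exists J'.
have sJ' (B : {set I}) : B \subset J' -> exists2 k, True & (pat k :&: J' = B)%SET.
  move=> BJ'; have [D] := sJ B (fintype.subset_trans BJ' J'J).
  move=> /imsetP[k _ ->] DJ; exists k => //.
  rewrite -{1}(finset.setIidPr J'J) finset.setIA DJ.
  exact/finset.setIidPl.
pose pt i := (w i, c i).
(* The points [(w i, c i)] may repeat, but not inside a shattered set: the pattern that isolates [i]
   tells its point from that of [i']. *)
have pt_inj i i' : i \in J' -> i' \in J' -> pt i = pt i' -> i = i'.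
  move=> iJ i'J [wi ci]; have [|k _] := sJ' [set i]%SET.
    by rewrite finset.sub1set.
  move=> /setP kE; have := kE i; have := kE i'.
  by rewrite !inE iJ i'J !andbT eqxx wi ci => -> /eqP.
exists [set pt (enum_val i) | i in [set: 'I_#|J'|]].
  apply: (card_eq_trans (inj_card_eq _)).
    move=> i i' _ _ /pt_inj; rewrite !enum_valP => /(_ isT isT).
    exact: enum_val_inj.
  by rewrite J'V; apply: card_esym; exact: card_II.
move=> B BA.
pose B' := [set i in J' | pt i \in B]%SET.
have [|k _ /setP kE] := sJ' B'.
  by apply/fintype.subsetP => i; rewrite inE => /andP[].
exists (subgraph (g k)); first by exists (g k).
apply/seteqP; split => [_ [[i /= _ <-] gk]|z Bz].
  have := kE (enum_val i); rewrite !inE enum_valP /= andbT.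
  by move: gk; rewrite /subgraph /= => -> /esym/set_mem.
have [i /= _ iz] := BA _ Bz; split; first by exists i.
have := kE (enum_val i); rewrite !inE enum_valP /= andbT iz mem_set//.
by rewrite /subgraph /= -iz.
Qed.

Lemma finite_threshold {R : realType} {m : nat} (x : 'I_m -> R) (P : R -> bool) :
  (forall a b, a <= b -> P a -> P b) ->
  exists c, forall k, P (x k) = (c < x k).
Proof.
(* [c0] lies below every [x k], so it is a valid threshold when no point is rejected by [P]. *)
move=> Pup; pose c0 := \big[Order.min/0]_k x k - 1.
exists (\big[Order.max/c0]_(k | ~~ P (x k)) x k) => k; apply/idP/idP => [Pk|].
  apply/bigmax_ltP; split => [|i /negP Pi].
    by rewrite ltrBlDr (le_lt_trans (bigmin_le _ k _))// ltrDl.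
  by rewrite ltNge; apply/negP => /Pup /(_ Pk).
by apply: contraTT => Pk; rewrite -leNgt le_bigmax_cond.
Qed.

(* The half-lines delimited by a unimodal predicate may be closed; on finitely many
   points they coincide with open ones. *)
Lemma unimodal_thresholds {R : realType} {m : nat} (x : 'I_m -> R) (y : R)
    (Q : R -> bool) :
  (forall a b, a <= b -> b < y -> Q a -> Q b) ->
  (forall a b, y < a -> a <= b -> Q b -> Q a) ->
  exists c : 'I_4 -> R, forall k k',
    (forall i, (c i < x k) = (c i < x k')) -> Q (x k) = Q (x k').
Proof.
move=> Ql Qr.
have up1 a b : a <= b -> (y < a) && ~~ Q a -> (y < b) && ~~ Q b.
  move=> ab /andP[ya Qa]; rewrite (lt_le_trans ya ab)/=.
  by apply: contra Qa; exact: Qr.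
have up2 a b : a <= b -> (y <= a) || Q a -> (y <= b) || Q b.
  move=> ab; have [//|yb] := leP y b; case/orP => [ya|]; last exact: Ql.
  by have := lt_le_trans yb (le_trans ya ab); rewrite ltxx.
(* [up2] encodes [Q] on the left of [y] and [up1] its complement on the right. The value of [Q] at
   [y] is arbitrary, so two more thresholds tell left, right and equal apart. *)
have [c1 c1P] := finite_threshold x (fun a => (y < a) && ~~ Q a) up1.
have [c2 c2P] := finite_threshold x (fun a => y <= a)
  (fun a b ab ya => le_trans ya ab).
have [c3 c3P] := finite_threshold x (fun a => y < a)
  (fun a b ab ya => lt_le_trans ya ab).
have [c4 c4P] := finite_threshold x (fun a => (y <= a) || Q a) up2.
exists (fun i => nth 0 [:: c1; c2; c3; c4] i) => k k' H.
have := H (@Ordinal 4 0 isT); have := H (@Ordinal 4 1 isT).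
have := H (@Ordinal 4 2 isT); have := H (@Ordinal 4 3 isT) => /=.
rewrite -!c1P -!c2P -!c3P -!c4P.
case: (ltgtP y (x k)) => /= yk; case: (ltgtP y (x k')) => //= yk'.
  by move=> _ _ _ /negb_inj.
by rewrite -yk yk'.
Qed.

(** The VC index only controls comparisons of [g] with constants. Each unimodal predicate is a
    function of four of them, whence the factor 4 in the number of points. *)
Lemma vc_unimodal_patterns {R : realType} {W : Type} (F : set (W -> R))
    (V m : nat) (J : finType) (w : J -> W) (y : J -> R) (Q : J -> R -> bool)
    (g : 'I_m -> W -> R) :
  vc_subgraph F V -> (forall k, F (g k)) ->
  (forall j a b, a <= b -> b < y j -> Q j a -> Q j b) ->
  (forall j a b, y j < a -> a <= b -> Q j b -> Q j a) ->
  exists pat : 'I_m -> {set (J * 'I_4)%type},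
    (#|[set pat k | k : 'I_m]%SET| <= \sum_(j < V) 'C(#|J| * 4, j))%N /\
    forall k k', pat k = pat k' ->
      forall j, Q j (g k (w j)) = Q j (g k' (w j)).
Proof.
move=> FV Fg Ql Qr.
pose x j k := g k (w j).
pose c j := sval (cid (unimodal_thresholds (x j) (y j) (Q j) (Ql j) (Qr j))).
have cP j : forall k k',
    (forall i, (c j i < x j k) = (c j i < x j k')) -> Q j (x j k) = Q j (x j k').
  by rewrite /c; case: cid.
exists (fun k => [set i | c i.1 i.2 < g k (w i.1)]%SET); split.
  have := @vc_card_patterns R W F V m (J * 'I_4)%type (fun i => w i.1)
    (fun i => c i.1 i.2) g FV Fg.
  by rewrite card_prod card_ord.
move=> k k' /setP kk' j; apply: cP => i.
by have := kk' (j, i); rewrite !inE.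
Qed.

Lemma same_levels_close {R : realType} (K : nat) (v v' : R) : (0 < K)%N ->
  `|v| <= 1 -> `|v'| <= 1 ->
  (forall l : 'I_(2 * K), (-1 + l%:R / K%:R < v) = (-1 + l%:R / K%:R < v')) ->
  `|v - v'| <= K%:R^-1.
Proof.
move=> K0; have K0' : (0 : R) < K%:R by rewrite ltr0n.
wlog vv' : v v' / v <= v'.
  move=> H v1 v'1 l; have [/H->//|/ltW/H] := leP v v'.
  by rewrite distrC; apply => // j; rewrite l.
move=> /ler_normlP[v1 _] /ler_normlP[_ v'1] lE.
rewrite distrC ger0_norm ?subr_ge0// lerBlDr leNgt; apply/negP => vv'K.
pose t := K%:R * (v + 1).
have t0 : 0 <= t by rewrite mulr_ge0 ?(ltW K0')// -lerBlDr sub0r lerNl.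
have /andP[t1 t2] := truncn_itv t0.
(* The first level above [v]: it is at most [v + K^-1 < v'], and its index is below [2 * K] because
   [v' <= 1]. *)
pose l := (Num.truncn t).+1.
have lv' : -1 + l%:R / K%:R < v'.
  apply: le_lt_trans vv'K; rewrite /l -natr1 mulrDl mul1r addrA [leRHS]addrC.
  by rewrite lerD2r addrC lerBlDr ler_pdivrMr// mulrC.
have lK : (l < 2 * K)%N.
  rewrite -(ltr_nat R) natrM -ltr_pdivrMr//.
  by move: (lt_le_trans lv' v'1); rewrite addrC ltrBlDr.
have := lE (Ordinal lK); rewrite /= lv' => vl; suff : v <= -1 + l%:R / K%:R by rewrite leNgt vl.
by rewrite addrC lerBrDr ler_pdivlMr// mulrC ltW.
Qed.

(** * Swapping two samples *)

Lemma expR_le_quadratic {R : realType} (x : R) : `|x| <= 2^-1 ->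
  expR x <= 1 + x + 2 * x ^+ 2.
Proof.
move=> /ler_normlP[x1 x2].
have x0 : 0 < 1 - x by lra.
have ex := expR_ge1Dx (- x).
have -> : expR x = (expR (- x))^-1 by rewrite expRN invrK.
apply: (@le_trans _ _ (1 - x)^-1).
  by rewrite lef_pV2 ?posrE ?expR_gt0.
rewrite -[leLHS]mul1r ler_pdivrMr//.
have : 0 <= x ^+ 2 * (1 - 2 * x) by rewrite mulr_ge0 ?sqr_ge0//; lra.
nra.
Qed.

(** The exponential moment of a random sign is at most [expR (2 * x ^+ 2)], which the factor
    [expR (- s)] compensates. *)
Lemma expR_two_point {R : realType} (x s : R) : `|x| <= 2^-1 -> 2 * x ^+ 2 <= s ->
  expR (x - s) + expR (- x - s) <= 2.
Proof.
move=> x1 xs; rewrite !expRD -mulrDl.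
have e1 := expR_le_quadratic x x1.
have e2 : expR (- x) <= 1 - x + 2 * x ^+ 2.
  by have := expR_le_quadratic (- x); rewrite normrN sqrrN; exact.
have e3 := expR_ge1Dx (2 * x ^+ 2).
apply: (@le_trans _ _ (2 * expR (2 * x ^+ 2) * expR (- s))).
  rewrite ler_wpM2r ?expR_ge0//; lra.
rewrite -mulrA -expRD ler_piMr// -[leRHS]expR0 ler_expR; lra.
Qed.

Section Swap.
Context {R : realType} (eps : R).
Hypothesis eps01 : 0 < eps <= 2^-1.

(** Here [a'] stems from the second sample; integrating it out leaves [a] minus the mean of
    [a' + eps * a' ^+ 2]. The factor 32 balances the two parts exactly: twice the squared
    antisymmetric part is at most [eps ^+ 2 / 64 * (a ^+ 2 + a' ^+ 2)], the size of the symmetric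
    part. *)
Definition swap_exponent (a a' : R) : R := eps / 32 * (a - (a' + eps * a' ^+ 2)).

(* With [M a = a + eps / 2 * a ^+ 2] the exponent is
   [eps / 32 * ((M a - M a') - eps / 2 * (a ^+ 2 + a' ^+ 2))]: an antisymmetric
   part compensated by a symmetric negative one. *)
Lemma swap_exponent_le2 (a a' : R) : `|a| <= 1 -> `|a'| <= 1 ->
  expR (swap_exponent a a') + expR (swap_exponent a' a) <= 2.
Proof.
move=> /ler_normlP[a1 a2] /ler_normlP[a'1 a'2].
have /andP[e0 e1] := eps01.
pose x := eps / 32 * (a - a') * (1 + eps / 2 * (a + a')).
pose s := eps / 32 * (eps / 2) * (a ^+ 2 + a' ^+ 2).
have -> : swap_exponent a a' = x - s by rewrite /swap_exponent /x /s; field.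
have -> : swap_exponent a' a = - x - s by rewrite /swap_exponent /x /s; field.
have u1 : `|1 + eps / 2 * (a + a')| <= 2 by apply/ler_normlP; split; nra.
have d1 : `|a - a'| <= 2 by apply/ler_normlP; split; lra.
apply: expR_two_point.
  have e32 : 0 <= eps / 32 <= 32^-1 by apply/andP; split; lra.
  have /andP[e3 e4] := e32.
  rewrite /x !normrM -(normrM eps) (ger0_norm (x := eps / 32))//.
  apply: (@le_trans _ _ (32^-1 * 2 * 2)); last by lra.
  apply: ler_pM => //; first exact: mulr_ge0.
  exact: ler_pM.
have u2 : (1 + eps / 2 * (a + a')) ^+ 2 <= 4.
  by rewrite -real_normK ?num_real//; have := normr_ge0 (1 + eps / 2 * (a + a')); nra.
have d2 : (a - a') ^+ 2 <= 2 * (a ^+ 2 + a' ^+ 2).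
  by have := sqr_ge0 (a + a'); nra.
rewrite /x /s !exprMn.
have : (a - a') ^+ 2 * (1 + eps / 2 * (a + a')) ^+ 2 <= 2 * (a ^+ 2 + a' ^+ 2) * 4.
  by rewrite ler_pM ?sqr_ge0.
have : 0 < eps ^+ 2 by rewrite exprn_gt0.
set A := (a - a') ^+ 2 * _; set B := (a ^+ 2 + a' ^+ 2).
move=> E AB; have -> : 2 * (eps ^+ 2 * 32^-1 ^+ 2 * (a - a') ^+ 2 *
  (1 + eps / 2 * (a + a')) ^+ 2) = eps ^+ 2 * (A / 512) by rewrite /A; field.
have -> : eps / 32 * (eps / 2) * B = eps ^+ 2 * (B / 64) by field.
by rewrite ler_pM2l//; lra.
Qed.

(** The slope in [a] is 1 and that of [a' + eps * a' ^+ 2] is bounded by 3 on [-1, 1]; their sum 4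
    turns [eps / 32] into [eps / 8]. *)
Lemma swap_exponent_lipschitz (a a' b b' delta : R) :
  `|a'| <= 1 -> `|b'| <= 1 ->
  `|a - b| <= delta -> `|a' - b'| <= delta ->
  swap_exponent a a' <= swap_exponent b b' + eps / 8 * delta.
Proof.
move=> /ler_normlP[a1 a2] /ler_normlP[b1 b2] /ler_normlP[_ ab]
  /ler_normlP[ab' ba'].
have /andP[e0 e1] := eps01.
have d0 : 0 <= delta by lra.
have -> : eps / 8 * delta = eps / 32 * (4 * delta) by field.
rewrite /swap_exponent -mulrDr ler_pM2l ?divr_gt0//.
have : (b' - a') * (1 + eps * (a' + b')) <= delta * 3.
  have c1 : 0 <= 1 + eps * (a' + b') by nra.
  have c2 : 1 + eps * (a' + b') <= 3 by nra.
  apply: (@le_trans _ _ (delta * (1 + eps * (a' + b')))); last exact: ler_wpM2l.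
  by apply: ler_wpM2r => //; lra.
by nra.
Qed.

(** The observations are fixed while the swaps vary, so the patterns do not depend on [s]. The
    maximum over [k] is then at most a sum over one representative per pattern, up to the
    discretization error. *)
Lemma sum_swap_le {m n : nat} {T : finType} (a a' : 'I_m -> 'I_n -> R)
    (pat : 'I_m -> T) (delta : R) :
  (forall k i, `|a k i| <= 1) -> (forall k i, `|a' k i| <= 1) ->
  (forall k k', pat k = pat k' -> forall i,
     `|a k i - a k' i| <= delta /\ `|a' k i - a' k' i| <= delta) ->
  \sum_(s : {ffun 'I_n -> bool}) \big[Order.max/0]_(k < m)
    expR (\sum_(i < n) if s i then swap_exponent (a' k i) (a k i)
                       else swap_exponent (a k i) (a' k i))
  <= 2 ^+ n * #|[set pat k | k : 'I_m]%SET|%:R * expR (n%:R * (eps / 8 * delta)).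
Proof.
move=> a1 a'1 close.
pose h k (s : {ffun 'I_n -> bool}) i := if s i then swap_exponent (a' k i) (a k i)
                       else swap_exponent (a k i) (a' k i).
pose D := [set pat k | k : 'I_m]%SET.
pose E := expR (n%:R * (eps / 8 * delta)).
pose rep (d : T) : option 'I_m := [pick k | pat k == d].
pose H d s := if rep d is Some k then expR (\sum_i h k s i) else 0.
have H0 d s : 0 <= H d s by rewrite /H; case: (rep d) => // k; exact: expR_ge0.
have sumH d : \sum_s H d s <= 2 ^+ n.
  rewrite /H; case: (rep d) => [k|]; last by rewrite big1// exprn_ge0.
  under eq_bigr do rewrite expR_sum.
  (* The sum over all swaps of a product over the coordinates is the product of the two-term
     sums. *)
  rewrite -(bigA_distr_bigA (fun i b => expR (if b then swap_exponent (a' k i) (a k i)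
                       else swap_exponent (a k i) (a' k i)))).
  apply: (@le_trans _ _ (\prod_(i < n) 2)); last first.
    by rewrite prodr_const card_ord.
  apply: ler_prod => i _; rewrite big_bool /=.
  by rewrite addr_ge0 ?expR_ge0//= swap_exponent_le2.
apply: (@le_trans _ _ (\sum_s \sum_(d in D) E * H d s)); last first.
  apply: (@le_trans _ _ (\sum_(d in D) E * 2 ^+ n)); last first.
    by rewrite sumr_const -[leLHS]mulr_natr [E * _]mulrC mulrAC.
  rewrite exchange_big /= ler_sum// => d _.
  by rewrite -mulr_sumr ler_wpM2l ?expR_ge0.
apply: ler_sum => s _; apply/bigmax_leP; split => [|k _].
  by apply: sumr_ge0 => d _; rewrite mulr_ge0 ?expR_ge0.
have patk : pat k \in D by apply/imsetP; exists k.
apply: (@le_trans _ _ (E * H (pat k) s)); last first.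
  rewrite (bigD1 (pat k))//= lerDl sumr_ge0// => d _.
  by rewrite mulr_ge0 ?expR_ge0.
rewrite /H /rep; case: pickP => [k' /eqP kk'|/(_ k)]; last by rewrite eqxx.
rewrite /E -expRD ler_expR mulr_natl.
rewrite -[X in _ *+ X](card_ord n) -sumr_const -big_split ler_sum// => i _ /=.
have [c c'] := close _ _ kk' i; rewrite addrC /h.
by case: (s i); apply: swap_exponent_lipschitz => //; rewrite distrC.
Qed.

End Swap.

(** * Symmetrization *)

Lemma bounded_integrable {d} {T : measurableType d} {R : realType}
    (P : probability T R) (f : T -> R) (M : R) :
  measurable_fun setT f -> (forall x, `|f x| <= M) ->
  P.-integrable setT (EFin \o f).
Proof.
move=> mf fM; apply: measurable_bounded_integrable => //.
  by apply: (@le_lt_trans _ _ 1%E); [exact: probability_le1|exact: ltry].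
exists M; split; first exact: num_real.
by move=> x Mx y _ /=; rewrite (le_trans (fM y))// ltW.
Qed.

Lemma measurable_bigmaxr {d} {T : measurableType d} {R : realType} {m : nat}
    (c : R) (f : 'I_m -> T -> R) :
  (forall k, measurable_fun setT (f k)) ->
  measurable_fun setT (fun x => \big[Order.max/c]_k f k x).
Proof.
move=> mf; elim: (index_enum _) => [|k s IH].
  by rewrite (_ : (fun x => _) = cst c)//; apply/funext => x; rewrite big_nil.
rewrite (_ : (fun x => _) = f k \max (fun x => \big[Order.max/c]_(j <- s) f j x)).
  exact: measurable_maxr.
by apply/funext => x; rewrite big_cons.
Qed.

Lemma integral_probability_cst {d} {T : measurableType d} {R : realType}
    (P : probability T R) (r : R) : (\int[P]_x r%:E = r%:E)%E.
Proof.
have -> : (fun=> r%:E) = cst r%:E :> (T -> \bar R) by [].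
by rewrite integral_cst//= (_ : P [set: T] = 1%E) ?mule1//; exact: probability_setT.
Qed.

(** Jensen's inequality through the tangent of [expR] at [v], which only requires a lower bound [v]
    on the mean. *)
Lemma expR_integral_le {d} {T : measurableType d} {R : realType}
    (P : probability T R) (Y : T -> R) (M v : R) :
  measurable_fun setT Y -> (forall x, `|Y x| <= M) ->
  (v%:E <= \int[P]_x (Y x)%:E)%E ->
  ((expR v)%:E <= \int[P]_x (expR (Y x))%:E)%E.
Proof.
move=> mY YM vY.
have iY := bounded_integrable P Y M mY YM.
have iE : P.-integrable setT (EFin \o (fun x => expR (Y x))).
  apply: (bounded_integrable P _ (expR M)); first exact: measurableT_comp.
  move=> x; rewrite ger0_norm ?expR_ge0// ler_expR.
  by rewrite (le_trans (ler_norm _)).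
have iD : P.-integrable setT (fun x => (Y x)%:E - (v - 1)%:E)%E.
  by apply: integrableB => //; exact: finite_measure_integrable_cst.
have iL : P.-integrable setT (fun x => (expR v)%:E * ((Y x)%:E - (v - 1)%:E))%E.
  exact: integrableZl.
apply: (@le_trans _ _ (\int[P]_x ((expR v)%:E * ((Y x)%:E - (v - 1)%:E)))%E).
  rewrite integralZl// integralB_EFin//; last exact: finite_measure_integrable_cst.
  rewrite [X in (_ - X)%E](_ : _ = (v - 1)%:E); last first.
    exact: integral_probability_cst.
  have := integrable_fin_num measurableT iY => /= /fineK yE.
  move: vY; rewrite -yE !lee_fin => vY; rewrite ler_peMr ?expR_ge0//; lra.
apply: le_integral => // x _; rewrite /= lee_fin.
have -> : expR (Y x) = expR v * expR (Y x - v) by rewrite -expRD addrC subrK.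
by rewrite ler_wpM2l ?expR_ge0//; have := expR_ge1Dx (Y x - v); lra.
Qed.

Lemma sume_cst {R : realType} (T : finType) (x : \bar R) :
  (\sum_(s : T) x = #|T|%:R%:E * x)%E.
Proof.
rewrite big_const; elim: #|T| => [|n IH]; first by rewrite mul0e.
by rewrite iterS IH -addn1 addnC natrD EFinD ge0_muleDl ?lee_fin// mul1e.
Qed.

Definition tuple_box {T : Type} {n : nat} (A : 'I_n -> set T) : set (n.-tuple T) :=
  [set x | forall i, A i (tnth x i)].

Lemma tuple_boxI {T : Type} {n : nat} (A B : 'I_n -> set T) :
  tuple_box A `&` tuple_box B = tuple_box (fun i => A i `&` B i).
Proof.
by apply/seteqP; split => [x [xA xB] i|x xAB]; split => // i; case: (xAB i).
Qed.

Lemma measurable_tuple_box {d} {T : measurableType d} {n : nat}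
    (A : 'I_n -> set T) :
  (forall i, measurable (A i)) -> measurable (tuple_box A).
Proof.
move=> mA; have -> : tuple_box A = \bigcap_(i in [set: 'I_n]) ((@tnth n T)^~ i @^-1` A i).
  by apply/seteqP; split => [x xA i _|x xA i]; exact: xA.
apply: fin_bigcap_measurable => // i _.
by rewrite -[X in measurable X]setTI; exact: measurable_tnth.
Qed.

Section PairBoxes.
Context {d} {T : measurableType d} {n : nat}.
Local Notation E := (n.-tuple T).

(** A generating family that is stable under the preimages of swaps, as the products of two
    arbitrary measurable sets of tuples are not. *)
Definition pair_boxes : set (set (E * E)) :=
  [set tuple_box A `*` tuple_box B | A in [set A | forall i, measurable (A i)]
    & B in [set B | forall i, measurable (B i)]].

Lemma measurable_pair_boxes : @measurable _ (E * E)%type = <<s pair_boxes >>.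
Proof.
apply/seteqP; split => [C mC|]; last first.
  apply: smallest_sub; first exact: sigma_algebra_measurable.
  by move=> _ [A mA [B mB <-]]; apply: measurableX; exact: measurable_tuple_box.
(* The inclusion amounts to the measurability of the identity out of the generated sigma-algebra,
   which is checked coordinate by coordinate. *)
pose G := g_sigma_algebraType pair_boxes.
pose f : G -> E * E := id.
suff mf : measurable_fun setT f.
  by have := mf measurableT C mC; rewrite setTI.
apply/measurable_fun_pairP; split; apply/measurable_fun_tnthP => i _ A mA;
  rewrite setTI; apply: sub_sigma_algebra.
  exists (fun j => if j == i then A else setT); first by move=> j; case: ifP.
  exists (fun _ => setT) => //; apply/seteqP; split => [[x y] [/= /(_ i) + _]|[x y] /= Ax].
    by rewrite eqxx.
  by split => // j; case: eqP => [->|].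
exists (fun _ => setT) => //.
exists (fun j => if j == i then A else setT); first by move=> j; case: ifP.
apply/seteqP; split => [[x y] [/= _ /(_ i)]|[x y] /= Ax].
  by rewrite eqxx.
by split => // j; case: eqP => [->|].
Qed.

Lemma pair_boxes_measure_unique {R : realType}
    (m1 m2 : {measure set (E * E) -> \bar R}) :
  (m1 setT < +oo)%E ->
  (forall A B, (forall i, measurable (A i)) -> (forall i, measurable (B i)) ->
     m1 (tuple_box A `*` tuple_box B) = m2 (tuple_box A `*` tuple_box B)) ->
  forall C, measurable C -> m1 C = m2 C.
Proof.
move=> m1oo m12 C mC.
apply: (measure_unique pair_boxes (fun _ => setT)) => //.
- exact: measurable_pair_boxes.
- move=> _ _ [A mA [B mB <-]] [A' mA' [B' mB' <-]].
  exists (fun i => A i `&` A' i); first by move=> i; exact: measurableI.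
  exists (fun i => B i `&` B' i); first by move=> i; exact: measurableI.
  by rewrite -!tuple_boxI setXI.
- move=> _; exists (fun _ => setT) => //; exists (fun _ => setT) => //.
  by apply/seteqP; split.
- by apply/seteqP; split => // x _; exists 0%N.
- by move=> _ [A mA [B mB <-]]; exact: m12.
Qed.

End PairBoxes.

Section Symmetrization.
Context {R : realType} {dO d : measure_display} {Omega : measurableType dO}
  {T : measurableType d} (P : probability Omega R) {n : nat}
  (X : 'I_n -> {RV P >-> T}).
Hypothesis indep : mutually_independent P (fun i => X i : Omega -> T).
Local Notation E := (n.-tuple T).

Let sampl (omega : Omega) : E := [tuple X i omega | i < n].

Lemma measurable_sample : measurable_fun setT sampl.
Proof.
apply/measurable_fun_tnthP => i.
rewrite (_ : _ \o _ = X i) //; apply/funext => omega /=.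
by rewrite tnth_mktuple.
Qed.

Lemma sample_tuple_box (A : 'I_n -> set T) : (forall i, measurable (A i)) ->
  P (sampl @^-1` tuple_box A) = (\prod_i P (X i @^-1` A i))%E.
Proof.
move=> mA; have := indep finset.setT A mA.
rewrite (eq_bigl xpredT); last by move=> i; rewrite inE.
move=> <-; congr (P _); apply/seteqP; split => [omega /= H i _|omega /= H i].
  by have := H i; rewrite tnth_mktuple.
by rewrite tnth_mktuple; apply: H; rewrite /= inE.
Qed.

Definition swap_pair (s : {ffun 'I_n -> bool}) (z : E * E) : E * E :=
  ([tuple if s i then tnth z.2 i else tnth z.1 i | i < n],
   [tuple if s i then tnth z.1 i else tnth z.2 i | i < n]).

Lemma measurable_swap_pair s : measurable_fun setT (swap_pair s).
Proof.
have m1 i : measurable_fun setT (fun z : E * E => tnth z.1 i).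
  by apply: (measurableT_comp (measurable_tnth i)).
have m2 i : measurable_fun setT (fun z : E * E => tnth z.2 i).
  by apply: (measurableT_comp (measurable_tnth i)).
apply: measurable_fun_pair; apply/measurable_fun_tnthP => i.
  rewrite (_ : _ \o _ = if s i then fun z : E * E => tnth z.2 i
                        else fun z : E * E => tnth z.1 i); first by case: ifP.
  by apply/funext => z /=; rewrite tnth_mktuple; case: ifP.
rewrite (_ : _ \o _ = if s i then fun z : E * E => tnth z.1 i
                      else fun z : E * E => tnth z.2 i); first by case: ifP.
by apply/funext => z /=; rewrite tnth_mktuple; case: ifP.
Qed.

Let double (z : Omega * Omega) : E * E := (sampl z.1, sampl z.2).

Let mdouble : measurable_fun setT double.
Proof.
apply: measurable_fun_pair.
  exact: (measurableT_comp measurable_sample).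
exact: (measurableT_comp measurable_sample).
Qed.

(** It suffices that the two image measures agree on pairs of boxes. There both are products of one
    factor per observation, and the swap exchanges the two factors of index [i]. *)
Lemma ge0_integral_swap (s : {ffun 'I_n -> bool}) (H : E * E -> \bar R) :
  measurable_fun setT H -> (forall z, 0 <= H z)%E ->
  (\int[P \x P]_z H (swap_pair s (double z)) = \int[P \x P]_z H (double z))%E.
Proof.
move=> mH H0.
have mswap : measurable_fun setT (swap_pair s \o double).
  by apply: measurableT_comp => //; exact: measurable_swap_pair.
pose D : {mfun (Omega * Omega)%type >-> (E * E)%type} :=
  HB.pack double (isMeasurableFun.Build _ _ _ _ _ mdouble).
pose S : {mfun (Omega * Omega)%type >-> (E * E)%type} :=
  HB.pack (swap_pair s \o double) (isMeasurableFun.Build _ _ _ _ _ mswap).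
transitivity (\int[pushforward (P \x P) S]_z H z)%E.
  by rewrite ge0_integral_pushforward//; exact: measurable_funP.
transitivity (\int[pushforward (P \x P) D]_z H z)%E; last first.
  by rewrite ge0_integral_pushforward//; exact: measurable_funP.
apply: eq_measure_integral => C mC _.
have pushE (Phi : Omega * Omega -> E * E) (A B A' B' : 'I_n -> set T) :
    (forall i, measurable (A i)) -> (forall i, measurable (B i)) ->
    Phi @^-1` (tuple_box A' `*` tuple_box B') =
      (sampl @^-1` tuple_box A) `*` (sampl @^-1` tuple_box B) ->
    pushforward (P \x P)%E Phi (tuple_box A' `*` tuple_box B') =
      (\prod_i P (X i @^-1` A i) * \prod_i P (X i @^-1` B i))%E.
  move=> mA mB PhiE; rewrite /pushforward PhiE product_measure1E.
  - by congr (_ * _)%E; exact: sample_tuple_box.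
  - by rewrite -[X in measurable X]setTI; apply: measurable_sample => //;
      exact: measurable_tuple_box.
  - by rewrite -[X in measurable X]setTI; apply: measurable_sample => //;
      exact: measurable_tuple_box.
apply: pair_boxes_measure_unique => //.
  change ((P \x P)%E ((swap_pair s \o double) @^-1` setT) < +oo)%E.
  rewrite preimage_setT -setXTT product_measure1E//.
  have PT : P [set: Omega] = 1%E by exact: probability_setT.
  by move: PT => /= ->; rewrite mule1 ltry.
move=> A B mA mB.
apply: (eq_trans (pushE (swap_pair s \o double) (fun i => if s i then B i else A i)
  (fun i => if s i then A i else B i) A B _ _ _)).
- by move=> i; case: ifP.
- by move=> i; case: ifP.
- apply/seteqP; split => [z [/= H1 H2]|z [/= H1 H2]]; split => i /=;
    have := H1 i; have := H2 i; rewrite !tnth_mktuple /=; by case: (s i).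
apply: esym; apply: (eq_trans (pushE double A B A B _ _ _)) => //.
by rewrite -!big_split /=; apply: eq_bigr => i _; case: (s i) => //; rewrite muleC.
Qed.

Lemma symmetrization (eps : R) {m : nat} (phi : 'I_m -> T -> R) (pb : 'I_m -> R)
    (c : R) :
  0 < eps <= 2^-1 ->
  (forall k, measurable_fun setT (phi k)) -> (forall k x, `|phi k x| <= 1) ->
  (forall k i, \int[P]_w (phi k (X i w) + eps * phi k (X i w) ^+ 2)%:E
    <= (pb k)%:E)%E ->
  (forall x x' : 'I_n -> T,
    \sum_(s : {ffun 'I_n -> bool}) \big[Order.max/0]_(k < m)
      expR (\sum_(i < n) if s i then swap_exponent eps (phi k (x' i)) (phi k (x i))
                         else swap_exponent eps (phi k (x i)) (phi k (x' i)))
    <= 2 ^+ n * c) ->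
  (\int[P]_w (\big[Order.max/0]_(k < m)
     expR (eps / 32 * \sum_(i < n) (phi k (X i w) - pb k)))%:E <= c%:E)%E.
Proof.
move=> eps01 mphi phi1 pbP comb; have /andP[e0 e1] := eps01.
pose sw := swap_exponent eps.
have msw (k : 'I_m) (i : 'I_n) : measurable_fun setT (fun z : E * E =>
    sw (phi k (tnth z.1 i)) (phi k (tnth z.2 i))).
  have m1 : measurable_fun setT (fun z : E * E => phi k (tnth z.1 i)).
    by apply: measurableT_comp => //; apply: (measurableT_comp (measurable_tnth i)).
  have m2 : measurable_fun setT (fun z : E * E => phi k (tnth z.2 i)).
    by apply: measurableT_comp => //; apply: (measurableT_comp (measurable_tnth i)).
  rewrite /sw /swap_exponent.
  apply: measurable_funM => //; apply: measurable_funB => //.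
  apply: measurable_funD => //; apply: measurable_funM => //.
  exact: measurable_funX.
pose H (z : E * E) := \big[Order.max/0]_(k < m)
  expR (\sum_(i < n) sw (phi k (tnth z.1 i)) (phi k (tnth z.2 i))).
have mH : measurable_fun setT H.
  apply: measurable_bigmaxr => k; apply: measurableT_comp => //.
  exact: measurable_sum.
have H0 z : 0 <= H z by exact: bigmax_ge_id.
pose I := (\int[P \x P]_z (H (double z))%:E)%E.
have mHd : measurable_fun setT (fun z => (H (double z))%:E).
  by apply/measurable_EFinP; apply: measurableT_comp.
have I_le : (I <= c%:E)%E.
  have IE s : (\int[P \x P]_z (H (swap_pair s (double z)))%:E = I)%E.
    rewrite (ge0_integral_swap s (fun z => (H z)%:E))//.
    exact/measurable_EFinP.
  have mHs s : measurable_fun setT (fun z => (H (swap_pair s (double z)))%:E).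
    apply/measurable_EFinP; apply: measurableT_comp => //.
    by apply: measurableT_comp => //; exact: measurable_swap_pair.
  rewrite -(@lee_pmul2l _ (2 ^+ n)%:E) ?ltry ?lte_fin ?exprn_gt0//.
  have -> : ((2 ^+ n)%:E * I =
      \sum_(s : {ffun 'I_n -> bool}) \int[P \x P]_z (H (swap_pair s (double z)))%:E)%E.
    under eq_bigr do rewrite IE.
    by rewrite sume_cst card_ffun card_ord card_bool natrX.
  rewrite -ge0_integral_sum//; last by move=> s z _; rewrite lee_fin.
  apply: (@le_trans _ _ (\int[P \x P]_z (2 ^+ n * c)%:E)%E).
    apply: ge0_le_integral => //.
    - by move=> z _; apply: sume_ge0 => s _; rewrite lee_fin.
    - exact: emeasurable_sum.
    move=> z _; rewrite sumEFin lee_fin.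
    apply: le_trans (comb (fun i => X i z.1) (fun i => X i z.2)).
    apply: ler_sum => s _; rewrite /H le_eqVlt; apply/orP; left; apply/eqP.
    apply: eq_bigr => k _; congr expR; apply: eq_bigr => i _.
    by rewrite /= !tnth_mktuple; case: (s i).
  have -> : (fun=> (2 ^+ n * c)%:E) = cst (2 ^+ n * c)%:E :> (Omega * Omega -> \bar R).
    by [].
  have PT : P [set: Omega] = 1%E by exact: probability_setT.
  have PP : (P \x P)%E [set: Omega * Omega] = 1%E.
    by rewrite -setXTT product_measure1E//; move: PT => /= ->; rewrite mule1.
  rewrite integral_cst//=; move: PP => /= ->.
  by rewrite mule1 EFinM.
apply: le_trans I_le.
(* For a fixed first sample, Jensen's inequality is applied to the integral over the second one. *)
rewrite /I (fubini_tonelli1 (fun z => (H (double z))%:E))//; last first.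
  by move=> z; rewrite lee_fin.
apply: ge0_le_integral => //.
- by move=> w _; rewrite lee_fin; exact: bigmax_ge_id.
- apply/measurable_EFinP; apply: measurable_bigmaxr => k.
  apply: measurableT_comp => //; apply: measurable_funM => //.
  apply: measurable_sum => i; apply: measurable_funB => //.
  exact: measurableT_comp.
- by apply: measurable_fun_fubini_tonelli_F => // z; rewrite lee_fin.
move=> w _; rewrite /fubini_F.
pose J := (\int[P]_y (H (double (w, y)))%:E)%E.
have J0 : (0 <= J)%E by apply: integral_ge0 => y _; rewrite lee_fin.
(* The integral of the maximum dominates each of the integrals, so [J] bounds the maximum once it
   bounds every term. *)
elim/big_ind : _ => //.
  by move=> a b aJ bJ; rewrite /Order.max; case: ifP.
move=> k _.
pose Y w' := \sum_(i < n) sw (phi k (X i w)) (phi k (X i w')).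
have mY : measurable_fun setT Y.
  apply: measurable_sum => i; rewrite /sw /swap_exponent.
  have m1 : measurable_fun setT (fun w' => phi k (X i w')).
    exact: measurableT_comp.
  apply: measurable_funM => //; apply: measurable_funB => //.
  apply: measurable_funD => //; apply: measurable_funM => //.
  exact: measurable_funX.
apply: (@le_trans _ _ (\int[P]_w' (expR (Y w'))%:E)%E); last first.
  apply: ge0_le_integral => //.
  - by apply/measurable_EFinP; apply: (measurableT_comp (@measurable_expR R) mY).
  - exact: (measurable_fun_pair2 w mHd).
  move=> w' _; rewrite lee_fin /H.
  apply: (@le_trans _ _ (expR (\sum_(i < n)
      sw (phi k (tnth (sampl w) i)) (phi k (tnth (sampl w') i))))).
    rewrite ler_expR le_eqVlt; apply/orP; left; apply/eqP.
    by apply: eq_bigr => i _; rewrite !tnth_mktuple.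
  exact: (le_bigmax _ _ k).
have sq1 x : phi k x ^+ 2 <= 1.
  by rewrite -real_normK ?num_real// expr_le1.
have mB i : measurable_fun setT (fun w' => phi k (X i w') + eps * phi k (X i w') ^+ 2).
  have m1 : measurable_fun setT (fun w' => phi k (X i w')).
    exact: measurableT_comp.
  apply: measurable_funD => //; apply: measurable_funM => //.
  exact: measurable_funX.
have B2 x : `|phi k x + eps * phi k x ^+ 2| <= 2.
  rewrite (le_trans (ler_normD _ _))// normrM (ger0_norm (sqr_ge0 _)) gtr0_norm//.
  have := phi1 k x; have := sq1 x; have := sqr_ge0 (phi k x); nra.
have iB i : P.-integrable setT
    (EFin \o (fun w' => phi k (X i w') + eps * phi k (X i w') ^+ 2)).
  exact: (bounded_integrable P _ 2).
have mS i : measurable_fun setT (fun w' => sw (phi k (X i w)) (phi k (X i w'))).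
  by rewrite /sw /swap_exponent; apply: measurable_funM => //; exact: measurable_funB.
have S3 i w' : `|sw (phi k (X i w)) (phi k (X i w'))| <= eps / 32 * 3.
  rewrite /sw /swap_exponent normrM ger0_norm; last by lra.
  rewrite ler_wpM2l//; first by lra.
  rewrite (le_trans (ler_normB _ _))//.
  have := phi1 k (X i w); have := B2 (X i w'); lra.
apply: (expR_integral_le P Y (\sum_(i < n) eps / 32 * 3)) => //.
  by move=> w'; apply: (le_trans (ler_norm_sum _ _ _)); exact: ler_sum.
under eq_integral do rewrite /Y -sumEFin.
rewrite integral_sum//; last first.
  by move=> i; exact: (bounded_integrable P _ _ (mS i) (S3 i)).
rewrite mulr_sumr -sumEFin; apply: lee_sum => i _.
rewrite /sw /swap_exponent.
under eq_integral do rewrite EFinM.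
have icst : P.-integrable setT (EFin \o cst (phi k (X i w))).
  exact: finite_measure_integrable_cst.
rewrite integralZl//; last by apply: (integrableB measurableT icst (iB i)).
rewrite integralB_EFin//.
rewrite [X in (_ * (X - _))%E](integral_probability_cst P).
rewrite EFinM lee_pmul2l ?lte_fin ?divr_gt0//.
rewrite EFinB; exact: leeB.
Qed.

End Symmetrization.

(** * Deviations uniform over a countable family *)

Lemma measurable_ge_set {d} {T : measurableType d} {R : realType}
    (Z : T -> R) (t : R) :
  measurable_fun setT Z -> measurable [set x | t <= Z x].
Proof.
move=> mZ; have mZ' : measurable_fun setT (EFin \o Z) by exact/measurable_EFinP.
have := emeasurable_fun_c_infty measurableT mZ' t%:E.
by rewrite setTI; congr measurable; apply/seteqP; split => x /=; rewrite lee_fin.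
Qed.

Lemma exp_markov {d} {T : measurableType d} {R : realType} (P : probability T R)
    (Z : T -> R) (t c : R) :
  measurable_fun setT Z -> (forall x, 0 <= Z x) ->
  (\int[P]_x (Z x)%:E <= c%:E)%E ->
  (P [set x | (expR t <= Z x)%R] <= (expR (- t) * c)%:E)%E.
Proof.
move=> mZ Z0 Zc.
have := @le_integral_comp_abse _ _ _ P setT measurableT (EFin \o Z) (expR t) id.
have mZ' : measurable_fun setT (EFin \o Z) by exact/measurable_EFinP.
move=> /(_ (@measurable_id _ _ _) (fun _ h => h) (fun _ _ _ _ h => h) mZ' (expR_gt0 t)).
rewrite setTI => H.
have {}H : ((expR t)%:E * P [set x | (expR t <= Z x)%R] <= c%:E)%E.
  apply: le_trans Zc; apply: le_trans (le_trans H _); last first.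
    apply: ge0_le_integral => //.
    - exact: measurableT_comp.
    - by move=> x _ /=; rewrite ger0_norm.
  apply: lee_pmul => //.
  rewrite le_eqVlt; apply/orP; left; apply/eqP; congr (P _).
  by apply/seteqP; split => x /=; rewrite lee_fin ger0_norm.
rewrite -(@lee_pmul2l _ (expR t)%:E) ?ltry ?lte_fin ?expR_gt0//.
by apply: (le_trans H); rewrite -EFinM mulrA -expRD subrr expR0 mul1r.
Qed.

Lemma probability_bigcup_le {d} {T : measurableType d} {R : realType}
    (P : probability T R) (A : nat -> set T) (c : \bar R) :
  (forall m, measurable (A m)) -> nondecreasing_seq A ->
  (forall m, (P (A m) <= c)%E) -> (P (\bigcup_m A m) <= c)%E.
Proof.
move=> mA ndA Pc.
have H := @nondecreasing_cvg_mu _ _ _ P A mA (bigcupT_measurable _ mA) ndA.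
rewrite -(cvg_lim _ H)//; apply: lime_le; first by apply/cvg_ex; exists (P (\bigcup_m A m)).
by apply: nearW => m /=.
Qed.

Section UniformDeviation.
Context {R : realType} {dO d : measure_display} {Omega : measurableType dO}
  {T : measurableType d} (P : probability Omega R) {n : nat}
  (X : 'I_n -> {RV P >-> T}).
Hypothesis indep : mutually_independent P (fun i => X i : Omega -> T).

(** The constant [c] does not depend on the number [m] of functions, so the bound for finite maxima
    passes to the whole sequence by continuity from below. *)
Lemma uniform_deviation (eps : R) (phi : nat -> T -> R) (pb : nat -> R) (c t : R) :
  0 < eps <= 2^-1 ->
  (forall k, measurable_fun setT (phi k)) -> (forall k x, `|phi k x| <= 1) ->
  (forall k i, \int[P]_w (phi k (X i w) + eps * phi k (X i w) ^+ 2)%:E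
    <= (pb k)%:E)%E ->
  (forall m (x x' : 'I_n -> T),
    \sum_(s : {ffun 'I_n -> bool}) \big[Order.max/0]_(k < m)
      expR (\sum_(i < n) if s i then swap_exponent eps (phi k (x' i)) (phi k (x i))
                         else swap_exponent eps (phi k (x i)) (phi k (x' i)))
    <= 2 ^+ n * c) ->
  (P [set w | exists k : nat, (t <= eps / 32 * \sum_(i < n) (phi k (X i w) - pb k))%R]
    <= (expR (- t) * c)%:E)%E.
Proof.
move=> eps01 mphi phi1 pbP comb.
pose Z m w := \big[Order.max/0]_(k < m)
  expR (eps / 32 * \sum_(i < n) (phi k (X i w) - pb k)).
have mZ m : measurable_fun setT (Z m).
  apply: measurable_bigmaxr => k.
  apply: measurableT_comp => //; apply: measurable_funM => //.
  apply: measurable_sum => i; apply: measurable_funB => //.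
  exact: measurableT_comp.
have -> : [set w | exists k : nat,
    (t <= eps / 32 * \sum_(i < n) (phi k (X i w) - pb k))%R] =
    \bigcup_m [set w | expR t <= Z m w].
  apply/seteqP; split => [w [k kt]|w [m _] /=].
    exists k.+1 => //=; apply: le_trans (le_bigmax _ _ (@ord_max k)) => /=.
    by rewrite ler_expR.
  move=> /bigmax_geP[|[k _]]; first by rewrite leNgt expR_gt0.
  by rewrite ler_expR => tk; exists k.
apply: probability_bigcup_le.
- by move=> m; exact: measurable_ge_set.
- move=> m m' mm'; apply/subsetPset => w /= Zm; apply: (le_trans Zm).
  apply/bigmax_leP; split; first exact: bigmax_ge_id.
  by move=> k _; apply: (le_bigmax _ _ (widen_ord mm' k)).
move=> m; apply: exp_markov => //; first by move=> w; exact: bigmax_ge_id.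
apply: (symmetrization P X indep eps (fun k : 'I_m => phi k) (fun k => pb k) c) => //.
Qed.

End UniformDeviation.

(** * The test of two densities *)

Section SignedRoot.
Context {R : realType}.
Implicit Types a b s : R.

(* At [a = b = 0] the division by [0] gives [0], in agreement with [psi 1 = 0] and
   the convention [0 / 0 = 1] of [density_ratio]. *)
Definition signed_root a b : R :=
  (Num.sqrt b - Num.sqrt a) / Num.sqrt (a + b).

Lemma psi_density_ratio a b : 0 <= a -> 0 <= b ->
  psi (er_map (@Num.sqrt R) (density_ratio b a)) = signed_root a b.
Proof.
move=> a0 b0; rewrite /density_ratio /signed_root.
have [->|an0] := eqVneq a 0.
  have [->|bn0] := eqVneq b 0.
    by rewrite /= sqrtr0 sqrtr1 !subrr !mul0r.
  by rewrite /= sqrtr0 subr0 add0r divff// gt_eqF// sqrtr_gt0 lt0r bn0.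
have {an0}a_gt0 : 0 < a by rewrite lt0r an0.
have sa : 0 < Num.sqrt a by rewrite sqrtr_gt0.
have sab : 0 < Num.sqrt (a + b) by rewrite sqrtr_gt0 ltr_pwDl.
rewrite /= sqr_sqrtr ?divr_ge0//.
have -> : 1 + b / a = (a + b) / a by field; rewrite gt_eqF.
rewrite !sqrtrM ?addr_ge0// sqrtrV//; field.
by rewrite !gt_eqF.
Qed.

Lemma signed_rootN a b : signed_root b a = - signed_root a b.
Proof. by rewrite /signed_root [b + a]addrC -mulNr opprB. Qed.

Lemma signed_root_sqr_le a b : 0 <= a -> 0 <= b ->
  (Num.sqrt b - Num.sqrt a) ^+ 2 <= a + b.
Proof.
move=> a0 b0; rewrite -{2}(sqr_sqrtr a0) -{2}(sqr_sqrtr b0).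
have := sqrtr_ge0 a; have := sqrtr_ge0 b; nra.
Qed.

Lemma signed_root_le1 a b : 0 <= a -> 0 <= b -> `|signed_root a b| <= 1.
Proof.
move=> a0 b0; rewrite /signed_root normrM normfV (ger0_norm (sqrtr_ge0 _)).
have [ab0|ab0] := eqVneq (Num.sqrt (a + b)) 0; first by rewrite ab0 invr0 mulr0.
have sab : 0 < Num.sqrt (a + b) by rewrite lt0r ab0 sqrtr_ge0.
rewrite ler_pdivrMr// mul1r -ler_sqr ?nnegrE ?sqrtr_ge0//.
by rewrite real_normK ?num_real// sqr_sqrtr ?addr_ge0// signed_root_sqr_le.
Qed.

(** This makes the level predicates of phi monotone in the second density, hence unimodal in the
    translation when that density is unimodal. *)
Lemma signed_root_homo a b b' : 0 <= a -> 0 <= b -> b <= b' ->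
  signed_root a b <= signed_root a b'.
Proof.
move=> a0 b0 bb'; have b'0 := le_trans b0 bb'.
have := ler_wsqrtr bb'; rewrite /signed_root.
set x := Num.sqrt a; set y := Num.sqrt b; set y' := Num.sqrt b' => yy'.
have x0 : 0 <= x by exact: sqrtr_ge0.
have y0 : 0 <= y by exact: sqrtr_ge0.
have y'0 : 0 <= y' by exact: sqrtr_ge0.
have aE : a = x ^+ 2 by rewrite sqr_sqrtr.
have bE : b = y ^+ 2 by rewrite sqr_sqrtr.
have b'E : b' = y' ^+ 2 by rewrite sqr_sqrtr.
have [ab'|ab'] := eqVneq (a + b') 0.
  have bb : b = b' by lra.
  by rewrite /y /y' bb.
have ab'0 : 0 < a + b' by rewrite lt0r ab' addr_ge0.
set S' := Num.sqrt (a + b').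
have S'0 : 0 < S' by rewrite sqrtr_gt0.
have S'E : S' ^+ 2 = x ^+ 2 + y' ^+ 2 by rewrite sqr_sqrtr ?addr_ge0// aE b'E.
set S := Num.sqrt (a + b).
have SE : S ^+ 2 = x ^+ 2 + y ^+ 2 by rewrite sqr_sqrtr ?addr_ge0// aE bE.
have [S0|S0] := eqVneq S 0.
  have [x00 y00] : x = 0 /\ y = 0.
    by move: SE; rewrite S0 expr0n /= => /esym/eqP; rewrite paddr_eq0 ?sqr_ge0//
      !expf_eq0 /= => /andP[/eqP ? /eqP ?].
  by rewrite x00 y00 !subr0 mul0r divr_ge0// ltW.
have {}S0 : 0 < S by rewrite lt0r S0 sqrtr_ge0.
rewrite ler_pdivrMr// mulrAC ler_pdivlMr//.
(* Once the signs are known, squares are compared. If [y] and [y'] lie on the same side of [x], then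
   [y * y' - x ^+ 2] has the common sign of [y - x] and [y' - x]; otherwise 0 separates the two
   sides. *)
have key : ((y' - x) * S) ^+ 2 - ((y - x) * S') ^+ 2 =
    2 * x * (y' - y) * (y * y' - x ^+ 2).
  by rewrite !exprMn SE S'E; ring.
have [xy|yx] := leP x y.
  have h1 : 0 <= (y - x) * S' by rewrite mulr_ge0 ?subr_ge0// ltW.
  have h2 : 0 <= (y' - x) * S by rewrite mulr_ge0 ?subr_ge0 ?(le_trans xy)// ltW.
  have h3 : 0 <= y * y' - x ^+ 2 by nra.
  rewrite -ler_sqr ?nnegrE// -subr_ge0 key; apply: mulr_ge0 => //.
  by rewrite !mulr_ge0// subr_ge0.
have [xy'|y'x] := leP x y'.
  apply: (@le_trans _ _ 0); first by rewrite mulr_le0_ge0 ?subr_le0 ?ltW.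
  by rewrite mulr_ge0 ?subr_ge0// ltW.
have h1 : 0 <= (x - y) * S' by apply: mulr_ge0; rewrite ?subr_ge0 ltW.
have h2 : 0 <= (x - y') * S by apply: mulr_ge0; rewrite ?subr_ge0 ltW.
have h3 : 0 <= x ^+ 2 - y * y' by nra.
rewrite -lerN2 -!mulNr !opprB -ler_sqr ?nnegrE// -subr_ge0.
have -> : ((x - y) * S') ^+ 2 - ((x - y') * S) ^+ 2 =
    2 * x * (y' - y) * (x ^+ 2 - y * y').
  by rewrite !exprMn SE S'E; ring.
by apply: mulr_ge0 => //; rewrite !mulr_ge0// subr_ge0.
Qed.

(** If [s <= 4 * (a + b)], the denominator of phi cancels [s]. Otherwise [sqrt s] is at least twice
    [sqrt a], and [phi ^+ 2 <= 1] is enough. *)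
Lemma signed_root_variance a b s : 0 <= a -> 0 <= b -> 0 <= s ->
  signed_root a b ^+ 2 * s <=
  8 * ((Num.sqrt s - Num.sqrt a) ^+ 2 + (Num.sqrt s - Num.sqrt b) ^+ 2).
Proof.
move=> a0 b0 s0.
have F1 := signed_root_le1 _ _ a0 b0.
have F2 : signed_root a b ^+ 2 <= 1 by rewrite -real_normK ?num_real// expr_le1.
set x := Num.sqrt a; set y := Num.sqrt b; set z := Num.sqrt s.
have x0 : 0 <= x by exact: sqrtr_ge0.
have y0 : 0 <= y by exact: sqrtr_ge0.
have z0 : 0 <= z by exact: sqrtr_ge0.
have aE : a = x ^+ 2 by rewrite sqr_sqrtr.
have bE : b = y ^+ 2 by rewrite sqr_sqrtr.
have sE : s = z ^+ 2 by rewrite sqr_sqrtr.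
have [sab|sab] := leP s (4 * (a + b)).
  apply: (@le_trans _ _ (4 * (y - x) ^+ 2)); last first.
    by have := sqr_ge0 ((z - x) + (z - y)); nra.
  have [ab0|ab0] := eqVneq (a + b) 0.
    have -> : s = 0 by apply/eqP; rewrite eq_le s0 andbT; lra.
    by rewrite mulr0 mulr_ge0 ?sqr_ge0.
  have {}ab0 : 0 < a + b by rewrite lt0r ab0 addr_ge0.
  rewrite /signed_root exprMn exprVn sqr_sqrtr ?(ltW ab0)// -/x -/y mulrAC ler_pdivrMr//.
  have : (y - x) ^+ 2 * s <= (y - x) ^+ 2 * (4 * (a + b)) by rewrite ler_wpM2l ?sqr_ge0.
  by rewrite [4 * _ * _]mulrAC [leRHS]mulrC.
apply: (@le_trans _ _ s); first by rewrite ler_piMl.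
have xz : 2 * x <= z by rewrite -ler_sqr ?nnegrE ?mulr_ge0//; nra.
have := sqr_ge0 (z - y); rewrite sE; nra.
Qed.

(* With [r = (a + b) / 2] and [phi = signed_root a b], the left-hand side without
   [phi ^+ 2] is
   [phi * (sqrt s - sqrt r) ^+ 2 / sqrt 2 + sqrt s * (sqrt b - sqrt a)], and
   [u |-> (sqrt s - sqrt u) ^+ 2] is convex. *)
Lemma signed_root_drift a b s : 0 <= a -> 0 <= b -> 0 <= s ->
  2^-1 * (Num.sqrt (b * ((a + b) / 2)) - Num.sqrt (a * ((a + b) / 2))) +
  (Num.sqrt 2)^-1 * ((signed_root a b + 100^-1 * signed_root a b ^+ 2) * s) <=
  (Num.sqrt s - Num.sqrt a) ^+ 2 - 16^-1 * (Num.sqrt s - Num.sqrt b) ^+ 2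
  + 2^-1 * (b - a).
Proof.
move=> a0 b0 s0.
have V := signed_root_variance _ _ _ a0 b0 s0.
have := signed_root_le1 _ _ a0 b0 => /ler_normlP[_ F1].
set k := (Num.sqrt 2)^-1.
have k0 : 0 < k by rewrite invr_gt0 sqrtr_gt0.
have k2 : k ^+ 2 = 2^-1 by rewrite exprVn sqr_sqrtr.
have k1 : k <= 72 / 100.
  rewrite -ler_sqr ?nnegrE ?ltW// k2; lra.
have ab0 : 0 <= a + b by rewrite addr_ge0.
have rE c : 0 <= c -> Num.sqrt (c * ((a + b) / 2)) =
    Num.sqrt c * (Num.sqrt (a + b) * k).
  by move=> c0; rewrite sqrtrM// sqrtrM// sqrtrV.
rewrite !rE//.
have SE : signed_root a b * Num.sqrt (a + b) = Num.sqrt b - Num.sqrt a.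
  have [S0|S0] := eqVneq (Num.sqrt (a + b)) 0; last by rewrite /signed_root divfK.
  have : a + b <= 0 by rewrite -sqrtr_eq0 S0.
  move=> ab00; have [-> ->] : a = 0 /\ b = 0 by split; lra.
  by rewrite addr0 sqrtr0 mulr0 subrr.
move: V F1 SE.
set f := signed_root a b; set x := Num.sqrt a; set y := Num.sqrt b.
set z := Num.sqrt s; set S := Num.sqrt (a + b).
move=> V F1 SE.
have x0 : 0 <= x by exact: sqrtr_ge0.
have y0 : 0 <= y by exact: sqrtr_ge0.
have z0 : 0 <= z by exact: sqrtr_ge0.
have S0 : 0 <= S by exact: sqrtr_ge0.
have aE : a = x ^+ 2 by rewrite sqr_sqrtr.
have bE : b = y ^+ 2 by rewrite sqr_sqrtr.
have sE : s = z ^+ 2 by rewrite sqr_sqrtr.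
have S2 : S ^+ 2 = x ^+ 2 + y ^+ 2 by rewrite sqr_sqrtr// aE bE.
pose r := k * S.
have r0 : 0 <= r by rewrite mulr_ge0// ltW.
have r2 : r ^+ 2 = (x ^+ 2 + y ^+ 2) / 2 by rewrite exprMn k2 S2 mulrC.
have rxy : x + y <= 2 * r.
  have h1 : 0 <= x + y by rewrite addr_ge0.
  have h2 : 0 <= 2 * r by rewrite mulr_ge0.
  rewrite -ler_sqr ?nnegrE// [leRHS]exprMn r2.
  by have := sqr_ge0 (x - y); nra.
have id1 : 2^-1 * (y * (S * k) - x * (S * k)) + k * (f * s) =
    k * f * (z - r) ^+ 2 + z * (y - x).
  have -> : y * (S * k) - x * (S * k) = f * S ^+ 2 * k.
    by rewrite -mulrBl -SE; ring.
  have -> : z * (y - x) = 2 * k ^+ 2 * z * (f * S).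
    by rewrite SE k2; field.
  have -> : (z - r) ^+ 2 = z ^+ 2 - 2 * z * (k * S) + 2^-1 * S ^+ 2.
    by rewrite sqrrB r2 /r S2; field.
  by rewrite sE; field.
have conv : (z - r) ^+ 2 <= 2^-1 * ((z - x) ^+ 2 + (z - y) ^+ 2).
  have h1 : z * (x + y) <= z * (2 * r) by rewrite ler_wpM2l.
  by rewrite sqrrB r2; nra.
have b1 : k * f * (z - r) ^+ 2 <= k * (z - r) ^+ 2.
  by rewrite ler_wpM2r ?sqr_ge0// ler_piMr// ltW.
have b2 : k * (z - r) ^+ 2 <= k * (2^-1 * ((z - x) ^+ 2 + (z - y) ^+ 2)).
  by rewrite ler_wpM2l// ltW.
have b3 : k * (100^-1 * (f ^+ 2 * s)) <=
    k * (100^-1 * (8 * ((z - x) ^+ 2 + (z - y) ^+ 2))).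
  by rewrite ler_wpM2l ?(ltW k0)// ler_wpM2l.
have b4 : k * ((z - x) ^+ 2 + (z - y) ^+ 2) <=
    72 / 100 * ((z - x) ^+ 2 + (z - y) ^+ 2).
  by rewrite ler_wpM2r// addr_ge0 ?sqr_ge0.
have -> : k * ((f + 100^-1 * f ^+ 2) * s) = k * (f * s) + k * (100^-1 * (f ^+ 2 * s)).
  by ring.
rewrite addrA id1.
have zyx : z * (y - x) = 2^-1 * ((z - x) ^+ 2 - (z - y) ^+ 2) + 2^-1 * (y ^+ 2 - x ^+ 2).
  by field.
rewrite zyx bE aE.
(* Convexity and variance together weigh [A] and [B] by at most [0.72 * (1/2 + 8/100) = 0.4176].
   Adding [1/2] for [A] leaves less than 1, and subtracting [1/2] for [B] leaves less than
   [- 1/16]. *)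
have := sqr_ge0 (z - x); have := sqr_ge0 (z - y).
move: b1 b2 b3 b4.
set A := (z - x) ^+ 2; set B := (z - y) ^+ 2; set D := (z - r) ^+ 2.
lra.
Qed.

End SignedRoot.

(** * Hellinger distance and the mean of the test *)

Section Densities.
Context {R : realType} {d : measure_display} {T : measurableType d}.
Variable m : {measure set T -> \bar R}.
Implicit Types (s t u v : T -> R).

Let I (f : T -> R) : R := Rintegral m setT f.
Let integrableR (f : T -> R) : Prop := m.-integrable setT (EFin \o f).

Lemma is_density_integrable u : is_density m u -> m.-integrable setT (EFin \o u).
Proof.
move=> [mu u0 u1]; apply/integrableP; split; first exact/measurable_EFinP.
under eq_integral => x _ do rewrite /= ger0_norm//.
by rewrite u1 ltry.
Qed.

Lemma is_density_Rintegral u : is_density m u -> Rintegral m setT u = 1.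
Proof. by move=> [_ _ u1]; rewrite /Rintegral u1. Qed.

Lemma integrable_dominated (f g : T -> R) :
  measurable_fun setT f -> m.-integrable setT (EFin \o g) ->
  (forall x, `|f x| <= g x) -> m.-integrable setT (EFin \o f).
Proof.
move=> mf ig fg; apply: (le_integrable _ _ _ ig) => //.
  exact/measurable_EFinP.
by move=> x _ /=; rewrite lee_fin (le_trans (fg x))// ler_norm.
Qed.

Lemma integrableR_D f g : integrableR f -> integrableR g ->
  integrableR (fun x => f x + g x).
Proof. exact: integrableD. Qed.

Lemma integrableR_B f g : integrableR f -> integrableR g ->
  integrableR (fun x => f x - g x).
Proof. exact: integrableB. Qed.

Lemma integrableR_Z c f : integrableR f -> integrableR (fun x => c * f x).
Proof. exact: integrableZl. Qed.

Lemma measurable_sqrt u : measurable_fun setT u ->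
  measurable_fun setT (fun x => Num.sqrt (u x)).
Proof.
move=> mu; apply: (measurableT_comp _ mu).
apply: continuous_measurable_fun; exact: sqrt_continuous.
Qed.

Lemma sqrt_sub_sqr_le (a b : R) : 0 <= a -> 0 <= b ->
  `|(Num.sqrt a - Num.sqrt b) ^+ 2| <= a + b.
Proof.
by move=> a0 b0; rewrite ger0_norm ?sqr_ge0// [a + b]addrC signed_root_sqr_le.
Qed.

Lemma sqrt_mul_le (a b : R) : 0 <= a -> 0 <= b ->
  `|Num.sqrt (a * b)| <= a + b.
Proof.
move=> a0 b0; rewrite ger0_norm ?sqrtr_ge0// sqrtrM//.
rewrite -{2}(sqr_sqrtr a0) -{2}(sqr_sqrtr b0).
have := sqrtr_ge0 a; have := sqrtr_ge0 b; nra.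
Qed.

Lemma integrable_sqrt_sub u v : is_density m u -> is_density m v ->
  m.-integrable setT (EFin \o (fun x => (Num.sqrt (u x) - Num.sqrt (v x)) ^+ 2)).
Proof.
move=> du dv; have [mu u0 _] := du; have [mv v0 _] := dv.
apply: (integrable_dominated _ (fun x => u x + v x)).
- apply: measurable_funX; apply: measurable_funB; exact: measurable_sqrt.
- by apply: integrableR_D; exact: is_density_integrable.
- by move=> x; exact: sqrt_sub_sqr_le.
Qed.

Lemma integrable_sqrt_mul u v : measurable_fun setT u -> measurable_fun setT v ->
  integrableR u -> integrableR v -> (forall x, 0 <= u x) -> (forall x, 0 <= v x) ->
  m.-integrable setT (EFin \o (fun x => Num.sqrt (u x * v x))).
Proof.
move=> mu mv iu iv u0 v0.
apply: (integrable_dominated _ (fun x => u x + v x)).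
- apply: measurable_sqrt; exact: measurable_funM.
- by apply: integrableR_D.
- by move=> x; exact: sqrt_mul_le.
Qed.

Lemma hellinger2_ge0 u v : 0 <= hellinger2 m u v.
Proof. by rewrite mulr_ge0// Rintegral_ge0// => x _; exact: sqr_ge0. Qed.

Lemma hellinger2C u v : hellinger2 m u v = hellinger2 m v u.
Proof.
congr (_ * _); apply: eq_Rintegral => x _.
by rewrite -sqrrN opprB.
Qed.

Lemma hellinger2_refl u : hellinger2 m u u = 0.
Proof.
rewrite /hellinger2; under eq_Rintegral do rewrite subrr expr0n.
by rewrite Rintegral_cst// mul0r mulr0.
Qed.

Lemma hellinger2_le1 u v : is_density m u -> is_density m v ->
  hellinger2 m u v <= 1.
Proof.
move=> du dv; have [mu u0 _] := du; have [mv v0 _] := dv.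
have iu := is_density_integrable u du; have iv := is_density_integrable v dv.
rewrite /hellinger2 ler_pdivrMl// mulr1.
apply: (@le_trans _ _ (I (fun x => u x + v x))).
  apply: le_Rintegral => //; first exact: integrable_sqrt_sub.
    exact: integrableR_D.
  by move=> x _; apply: (le_trans (ler_norm _)); exact: sqrt_sub_sqr_le.
rewrite /I RintegralD// !is_density_Rintegral//.
Qed.

Lemma hellinger2_triangle s t u : is_density m s -> is_density m t ->
  is_density m u ->
  hellinger2 m s u <= 2 * hellinger2 m s t + 2 * hellinger2 m t u.
Proof.
move=> ds dt du; rewrite /hellinger2.
have ist := integrable_sqrt_sub s t ds dt.
have itu := integrable_sqrt_sub t u dt du.
have isu := integrable_sqrt_sub s u ds du.
suff : I (fun x => (Num.sqrt (s x) - Num.sqrt (u x)) ^+ 2) <=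
  2 * I (fun x => (Num.sqrt (s x) - Num.sqrt (t x)) ^+ 2) +
  2 * I (fun x => (Num.sqrt (t x) - Num.sqrt (u x)) ^+ 2).
  rewrite /I; lra.
rewrite /I -!RintegralZl// -RintegralD//; [|exact: integrableR_Z..].
apply: le_Rintegral => //.
  by apply: integrableR_D; exact: integrableR_Z.
move=> x _; move: (Num.sqrt _) (Num.sqrt _) (Num.sqrt _) => a b c.
by have := sqr_ge0 ((c - a) - (a - b)); nra.
Qed.

Lemma hellinger_lt u v e : 0 < e -> (hellinger m u v < e) = (hellinger2 m u v < e ^+ 2).
Proof.
move=> e0; rewrite /hellinger -{1}(ger0_norm (ltW e0)) -sqrtr_sqr.
by rewrite ltr_sqrt// exprn_gt0.
Qed.

Lemma measurable_signed_root u v : measurable_fun setT u -> measurable_fun setT v ->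
  measurable_fun setT (fun x => signed_root (u x) (v x)).
Proof.
move=> mu mv; rewrite /signed_root.
have mN : measurable_fun setT (fun x => Num.sqrt (v x) - Num.sqrt (u x)).
  by apply: measurable_funB; exact: measurable_sqrt.
apply: measurable_funM => //.
have mS : measurable_fun setT (fun x => Num.sqrt (u x + v x)).
  by apply: measurable_sqrt; exact: measurable_funD.
(* On nonnegative reals the power -1 agrees with the inverse even at 0, and it is measurable. *)
rewrite (_ : (fun x => _) = (fun x => (Num.sqrt (u x + v x)) `^ (-1))).
  exact: (measurableT_comp (measurable_powR _) mS).
by apply/funext => x; rewrite powR_inv1// sqrtr_ge0.
Qed.

(** The centring of the symmetrization for [eps = 100^-1]; it includes the quadratic term that
    compensates the fluctuations. *)
Definition test_mean s t t' : R := Rintegral m setT (fun x =>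
  (signed_root (t x) (t' x) + 100^-1 * signed_root (t x) (t' x) ^+ 2) * s x).

Lemma signed_root_test_bound (a b : R) : 0 <= a -> 0 <= b ->
  `|signed_root a b + 100^-1 * signed_root a b ^+ 2| <= 2.
Proof.
move=> a0 b0; have F1 := signed_root_le1 _ _ a0 b0.
have F2 : `|100^-1 * signed_root a b ^+ 2| = 100^-1 * signed_root a b ^+ 2.
  by rewrite ger0_norm// mulr_ge0 ?sqr_ge0.
rewrite (le_trans (ler_normD _ _))// F2.
have : signed_root a b ^+ 2 <= 1 by rewrite -real_normK ?num_real// expr_le1.
lra.
Qed.

Lemma measurable_test t t' : is_density m t -> is_density m t' ->
  measurable_fun setT (fun x =>
    signed_root (t x) (t' x) + 100^-1 * signed_root (t x) (t' x) ^+ 2).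
Proof.
move=> [mt _ _] [mt' _ _]; have := measurable_signed_root t t' mt mt' => mphi.
apply: measurable_funD => //; apply: measurable_funM => //.
exact: measurable_funX.
Qed.

Lemma test_drift s t t' : is_density m s -> is_density m t -> is_density m t' ->
  2^-1 * (affinity m t' (fun x => (t x + t' x) / 2)
          - affinity m t (fun x => (t x + t' x) / 2))
  + (Num.sqrt 2)^-1 * test_mean s t t'
  <= 2 * hellinger2 m s t - 8^-1 * hellinger2 m s t'.
Proof.
move=> ds dt dt'; have [ms s0 _] := ds; have [mt t0 _] := dt; have [mt' t'0 _] := dt'.
have is_ := is_density_integrable s ds; have it := is_density_integrable t dt.
have it' := is_density_integrable t' dt'.
pose r x := (t x + t' x) / 2.
have ir : integrableR r.
  rewrite (_ : r = fun x => 2^-1 * (t x + t' x)).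
    by apply: integrableR_Z; exact: integrableR_D.
  by apply/funext => x; rewrite /r mulrC.
have mr : measurable_fun setT r.
  by apply: measurable_funM => //; exact: measurable_funD.
have r0 x : 0 <= r x by rewrite divr_ge0// addr_ge0.
have i1 := integrable_sqrt_mul t' r mt' mr it' ir t'0 r0.
have i2 := integrable_sqrt_mul t r mt mr it ir t0 r0.
have iG : integrableR (fun x =>
    (signed_root (t x) (t' x) + 100^-1 * signed_root (t x) (t' x) ^+ 2) * s x).
  apply: (integrable_dominated _ (fun x => 2 * s x)).
  - by apply: measurable_funM => //; exact: measurable_test.
  - exact: integrableR_Z.
  - by move=> x; rewrite normrM (ger0_norm (s0 x)) ler_wpM2r// signed_root_test_bound.
have h1 := integrable_sqrt_sub s t ds dt.
have h2 := integrable_sqrt_sub s t' ds dt'.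
have e1 : 2 * hellinger2 m s t = I (fun x => (Num.sqrt (s x) - Num.sqrt (t x)) ^+ 2).
  by rewrite /hellinger2 mulrA mulfV// mul1r.
have e2 : 8^-1 * hellinger2 m s t' =
    I (fun x => 16^-1 * (Num.sqrt (s x) - Num.sqrt (t' x)) ^+ 2).
  rewrite /hellinger2 /I RintegralZl// mulrA; congr (_ * _); lra.
(* The term [2^-1 * (b - a)] of the pointwise inequality integrates to 0, both densities having mass
   1. *)
have e3 : 0 = I (fun x => 2^-1 * (t' x - t x)).
  rewrite /I RintegralZl//; last exact: integrableR_B.
  by rewrite RintegralB// !is_density_Rintegral// subrr mulr0.
rewrite e1 e2 -[leRHS]addr0 {1}e3 /affinity /test_mean /I.
rewrite -RintegralB// -!RintegralZl//; last exact: integrableR_B.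
rewrite -RintegralD//; [|exact: integrableR_Z (integrableR_B _ _ _ _)|exact: integrableR_Z].
have iR1 := integrableR_B _ _ h1 (integrableR_Z 16^-1 _ h2).
have iR2 := integrableR_Z 2^-1 _ (integrableR_B _ _ it' it).
rewrite -RintegralB//; last exact: integrableR_Z.
rewrite -RintegralD//.
apply: le_Rintegral => //.
- apply: integrableR_D; last exact: integrableR_Z.
  by apply: integrableR_Z; exact: integrableR_B.
- exact: integrableR_D.
- by move=> x _; exact: signed_root_drift.
Qed.

End Densities.

(** * Measurable choice of an index *)

Lemma countable_enumeration {T : Type} (S : set T) : countable S -> S !=set0 ->
  exists e : nat -> T, range e = S.
Proof.
move=> /pfcard_geP[->[x]//|[f]] _; exists f; apply/seteqP; split.
  by move=> _ [k _ <-]; exact: funS.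
by move=> x /(@surj _ _ _ _ f)[k _ <-]; exists k.
Qed.

(** The least admissible index is chosen: its fibre over [k] is [C k] minus the earlier [C j]. *)
Lemma measurable_selector {d} {E : measurableType d} (C : nat -> set E) :
  (forall k, measurable (C k)) -> (forall x, exists k, C k x) ->
  exists sel : E -> nat, (forall x, C (sel x) x) /\
    forall B : set nat, measurable (sel @^-1` B).
Proof.
move=> mC Cx.
have ex x : exists k, `[< C k x >] by have [k] := Cx x; exists k; apply/asboolP.
pose sel x := ex_minn (ex x); exists sel; split => [x|B].
  by rewrite /sel; case: ex_minnP => k /asboolP.
have selE k : sel @^-1` [set k] = C k `\` \bigcup_(j < k) C j.
  apply/seteqP; split => [x /= <-|x [Ck nC]] /=.
    rewrite /sel; case: ex_minnP => i /asboolP Ci imin; split => // -[j /= ji Cj].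
    by have := imin j (introT (asboolP _) Cj); rewrite leqNgt ji.
  rewrite /sel; case: ex_minnP => i /asboolP Ci imin; apply/eqP.
  rewrite eqn_leq imin ?andbT; last exact/asboolP.
  by rewrite leqNgt; apply/negP => ik; apply: nC; exists i.
have -> : sel @^-1` B = \bigcup_(k in B) sel @^-1` [set k].
  apply/seteqP; split => [x Bx|x [k Bk /= kx]]; first by exists (sel x).
  by rewrite /= kx.
apply: bigcup_measurable => k _; rewrite selE; apply: measurableD => //.
exact: bigcup_measurable.
Qed.

Lemma measurable_esup_range {d} {E : measurableType d} {R : realType}
    (f : nat -> E -> \bar R) : (forall k, measurable_fun setT (f k)) ->
  measurable_fun setT (fun x => ereal_sup (range (f ^~ x))).
Proof.
move=> mf; have := @measurable_fun_esups _ _ _ setT f mf 0%N.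
congr measurable_fun; apply/funext => x; rewrite /esups /=; congr ereal_sup.
by apply/seteqP; split => [_ [k _ <-]|_ [k _ <-]]; exists k.
Qed.

Lemma measurable_einf_range {d} {E : measurableType d} {R : realType}
    (f : nat -> E -> \bar R) : (forall k, measurable_fun setT (f k)) ->
  measurable_fun setT (fun x => ereal_inf (range (f ^~ x))).
Proof.
move=> mf; have := @measurable_fun_einfs _ _ _ setT f mf 0%N.
congr measurable_fun; apply/funext => x; rewrite /einfs /=; congr ereal_inf.
by apply/seteqP; split => [_ [k _ <-]|_ [k _ <-]]; exists k.
Qed.

(** * Candidates of the rho-estimation procedure *)

Section Rho.
Context {R : realType} {d : measure_display} {T : measurableType d}.
Variable m : {measure set T -> \bar R}.
Implicit Types (t : T -> R) (S : set (T -> R)).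

Lemma rho_testE (n : nat) (x : n.-tuple T) t t' :
  (forall y, 0 <= t y) -> (forall y, 0 <= t' y) ->
  rho_test m x t t' = n%:R / 2 *
      (affinity m t' (fun y => (t y + t' y) / 2)
       - affinity m t (fun y => (t y + t' y) / 2))
    + (Num.sqrt 2)^-1 * \sum_(i < n) signed_root (t (tnth x i)) (t' (tnth x i)).
Proof.
move=> t0 t'0; rewrite /rho_test; congr (_ + _ * _).
by apply: eq_bigr => i _; rewrite psi_density_ratio.
Qed.

Lemma rho_testN (n : nat) (x : n.-tuple T) t t' :
  (forall y, 0 <= t y) -> (forall y, 0 <= t' y) ->
  rho_test m x t' t = - rho_test m x t t'.
Proof.
move=> t0 t'0; rewrite !rho_testE// opprD -!mulrN -sumrN opprB.
congr (_ * _ + _ * _); last by apply: eq_bigr => i _; rewrite signed_rootN.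
by congr (affinity m _ _ - affinity m _ _); apply/funext => y; rewrite [t' y + t y]addrC.
Qed.

(** By antisymmetry one family of bounds serves twice: it bounds the supremum at [tb] from above,
    and it bounds the supremum at [sh] from below through the test of [sh] against [tb]. *)
Lemma rho_candidate_risk (n : nat) (x : n.-tuple T) S s tb sh (Z : R) :
  (0 < n)%N -> S `<=` is_density m -> S tb -> rho_candidates m x S sh ->
  (forall t, S t -> rho_test m x tb t <=
     n%:R * (2 * hellinger2 m s tb - 8^-1 * hellinger2 m s t) + Z) ->
  hellinger2 m s sh <= 32 * hellinger2 m s tb + (16 * Z + 288) / n%:R.
Proof.
move=> n0 Sd Stb [Ssh sh_min] H.
have n0' : (0 : R) < n%:R by rewrite ltr0n.
have tb0 : forall y, 0 <= tb y by have [] := Sd _ Stb.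
have sh0 : forall y, 0 <= sh y by have [] := Sd _ Ssh.
set hb := hellinger2 m s tb in H *; set h := hellinger2 m s sh.
have up : (rho_sup m x S tb <= (n%:R * (2 * hb) + Z)%:E)%E.
  apply: ge_ereal_sup => _ [t St <-]; rewrite lee_fin (le_trans (H t St))//.
  by rewrite lerD2r ler_pM2l// gerBl mulr_ge0// hellinger2_ge0.
have lo : ((rho_test m x sh tb)%:E <= rho_sup m x S sh)%E.
  by apply: ereal_sup_ubound; exists tb.
have : ((rho_test m x sh tb)%:E <= (n%:R * (2 * hb) + Z)%:E + (kappa / 10)%:E)%E.
  apply: (le_trans lo); apply: (le_trans sh_min); rewrite leeD2r//.
  by apply: le_trans up; apply: ereal_inf_lbound; exists tb.
rewrite -EFinD lee_fin rho_testN// => H1; have H2 := H _ Ssh.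
rewrite -/h in H2.
(* Multiplying by 8 clears the factor [8^-1] of [h]; the slack [kappa / 10] becomes 285.6, rounded
   up to 288. *)
have : n%:R * h <= n%:R * (32 * hb) + (16 * Z + 288).
  move: H1 H2; rewrite mulrBr /kappa; lra.
move=> H3; rewrite -(ler_pM2l n0') mulrDr [_ * (_ / _)]mulrC divfK// gt_eqF//.
Qed.

(** The infimum is nonnegative since the test of [t] against itself vanishes. It may be [+oo], and
    then every member of [S] is a candidate. *)
Lemma rho_candidates_nonempty (n : nat) (x : n.-tuple T) S :
  S !=set0 -> S `<=` is_density m -> rho_candidates m x S !=set0.
Proof.
move=> [t0 St0] Sd.
have sup0 t : S t -> (0 <= rho_sup m x S t)%E.
  move=> St; have tp : forall y, 0 <= t y by have [] := Sd _ St.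
  apply: ereal_sup_ubound; exists t => //.
  have := rho_testN _ x t t tp tp; move/eqP; rewrite -addr_eq0 -mulr2n mulrn_eq0 /=.
  by move/eqP => ->.
set J := ereal_inf [set rho_sup m x S u | u in S].
have J0 : (0 <= J)%E by apply: le_ereal_inf_tmp => _ [u Su <-]; exact: sup0.
have [Jfin|Jinf] := boolP (J \is a fin_num).
  have k0 : 0 < kappa / 10 :> R by rewrite divr_gt0.
  have [_ [t St <-] tJ] := lb_ereal_inf_adherent k0 Jfin.
  by exists t; split => //; exact: ltW.
exists t0; split => //; rewrite -/J.
move: Jinf J0; case: J => //= _ _.
by rewrite leey.
Qed.

Lemma rho_selector (n : nat) (e : nat -> T -> R) :
  (forall k, is_density m (e k)) ->
  exists sel : n.-tuple T -> nat,
    (forall x, rho_candidates m x (range e) (e (sel x))) /\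
    forall B : set nat, measurable (sel @^-1` B).
Proof.
move=> ed.
have Sd : range e `<=` is_density m by move=> _ [k _ <-].
have mtest k j : measurable_fun setT (fun x : n.-tuple T => (rho_test m x (e k) (e j))%:E).
  have [mk k0 _] := ed k; have [mj j0 _] := ed j.
  apply/measurable_EFinP.
  rewrite (_ : (fun x => _) = fun x : n.-tuple T => n%:R / 2 *
      (affinity m (e j) (fun y => (e k y + e j y) / 2)
       - affinity m (e k) (fun y => (e k y + e j y) / 2))
    + (Num.sqrt 2)^-1 * \sum_(i < n) signed_root (e k (tnth x i)) (e j (tnth x i))).
    apply: measurable_funD => //; apply: measurable_funM => //.
    apply: measurable_sum => i.
    exact: (measurableT_comp (measurable_signed_root _ _ mk mj) (measurable_tnth i)).
  by apply/funext => x; rewrite rho_testE.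
have supE x t : rho_sup m x (range e) t = ereal_sup (range (fun j => (rho_test m x t (e j))%:E)).
  congr ereal_sup; apply/seteqP; split => [_ [_ [j _ <-] <-]|_ [j _ <-]].
    by exists j.
  by exists (e j).
have msup k : measurable_fun setT (fun x : n.-tuple T => rho_sup m x (range e) (e k)).
  under eq_fun do rewrite supE.
  by apply: measurable_esup_range.
have infE (x : n.-tuple T) : ereal_inf [set rho_sup m x (range e) u | u in range e] =
    ereal_inf (range (fun k => rho_sup m x (range e) (e k))).
  congr ereal_inf; apply/seteqP; split => [_ [_ [j _ <-] <-]|_ [j _ <-]].
    by exists j.
  by exists (e j).
apply: (measurable_selector (fun k => [set x | rho_candidates m x (range e) (e k)])) => [k|x].
  rewrite -[X in measurable X]setTI (_ : setT `&` _ = setT `&` [set x : n.-tuple T |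
    (rho_sup m x (range e) (e k) <=
     ereal_inf (range (fun k => rho_sup m x (range e) (e k))) + (kappa / 10)%:E)%E]).
    apply: measurable_lee => //; apply: emeasurable_funD => //.
    exact: measurable_einf_range.
  by apply/seteqP; split => [x [_ [_]]|x [_ /= H]]; rewrite /= ?infE //; split => //;
    split; [exists k|rewrite infE].
have S0 : range e !=set0 by exists (e 0%N); exists 0%N.
have [t [St tc]] := rho_candidates_nonempty n x _ S0 Sd.
by have [k _ kt] := St; exists k; rewrite kt; split.
Qed.

End Rho.

(** * Regression models *)

Section IdentifiableSubset.
Context {R : realType} {d : measure_display} {T : measurableType d}.
Variable m : {measure set T -> \bar R}.

(** From each class of densities of [A] at mutual distance 0, only the one of least index is
    kept. *)
Lemma identifiable_dense (A S : set (T -> R)) : countable_dense_subset m A S ->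
  exists2 A' : set (T -> R), countable_dense_subset m A' S & identifiable m A'.
Proof.
move=> [cA AS SA]; have /countable_injP[idx idxI] := cA.
have Ad t : A t -> is_density m t by move=> /AS/SA[].
pose A' : set (T -> R) := [set t | A t /\
  forall t', A t' -> hellinger2 m t t' = 0 -> (idx t <= idx t')%N].
exists A'; last first.
  move=> t t' [At tm] [At' t'm] tt'; rewrite /hellinger sqrtr_gt0.
  rewrite lt0r hellinger2_ge0 andbT; apply/eqP => h0; apply: tt'.
  apply: idxI; rewrite ?inE//; apply/eqP; rewrite eqn_leq tm//= t'm//.
  by rewrite hellinger2C.
split.
- by apply: sub_countable cA; apply: subset_card_le => t [].
- by move=> t [/AS].
move=> t St; have [dt tA] := SA _ St; split => // e e0.
pose e' := Num.sqrt (e ^+ 2 / 2).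
have e'0 : 0 < e' by rewrite sqrtr_gt0 divr_gt0// exprn_gt0.
have [u Au] := tA e' e'0.
rewrite hellinger_lt// /e' sqr_sqrtr ?divr_ge0 ?sqr_ge0// => tu.
(* A close [u] in [A] is replaced by the representative of its class, which is at the same distance;
   by the triangle inequality, being at distance 0 is transitive, so that representative belongs to
   [A']. *)
have ex : exists k, `[< exists2 v, A v /\ hellinger2 m u v = 0 & idx v = k >].
  by exists (idx u); apply/asboolP; exists u => //; split => //; exact: hellinger2_refl.
have [k /asboolP[v [Av uv] vk] kmin] := ex_minnP ex.
exists v.
  split => // v' Av' vv'; rewrite vk; apply: kmin; apply/asboolP; exists v' => //.
  split => //; apply/eqP; rewrite eq_le hellinger2_ge0 andbT.
  have := hellinger2_triangle m u v v' (Ad _ Au) (Ad _ Av) (Ad _ Av').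
  by rewrite uv vv' !mulr0 addr0.
rewrite hellinger_lt//.
have := hellinger2_triangle m t u v dt (Ad _ Au) (Ad _ Av).
rewrite uv mulr0 addr0 => H; apply: (le_lt_trans H).
by rewrite mulrC -ltr_pdivlMr.
Qed.

End IdentifiableSubset.

(** * The probability with a given density *)

Section DensityMeasure.
Context {R : realType} {d : measure_display} {T : measurableType d}.
Variables (m : {sigma_finite_measure set T -> \bar R}) (u : T -> R).
Hypothesis du : is_density m u.

(* The argument is only there for the inference of the measure structure. *)
Definition density_measure of is_density m u : set T -> \bar R :=
  fun A => (\int[m]_(x in A) (u x)%:E)%E.

Let measurable_u : measurable_fun setT (fun x => (u x)%:E).
Proof. by have [mu _ _] := du; exact/measurable_EFinP. Qed.

Let u0 x : (0 <= (u x)%:E)%E.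
Proof. by have [_ u0 _] := du; rewrite lee_fin. Qed.

Let dens0 : density_measure du set0 = 0%E.
Proof. by rewrite /density_measure integral_set0. Qed.

Let dens_ge0 A : (0 <= density_measure du A)%E.
Proof. by apply: integral_ge0 => x _; exact: u0. Qed.

Let dens_sigma_additive : semi_sigma_additive (density_measure du).
Proof.
move=> F mF tF mUF; rewrite /density_measure ge0_integral_bigcup//.
  by apply: is_cvg_ereal_nneg_natsum_cond => n _ _; exact: integral_ge0.
exact: measurable_funTS.
Qed.

HB.instance Definition _ := isMeasure.Build _ _ _ (density_measure du)
  dens0 dens_ge0 dens_sigma_additive.

Let densT : density_measure du setT = 1%E.
Proof. by have [_ _] := du. Qed.

HB.instance Definition _ := Measure_isProbability.Build _ _ _
  (density_measure du) densT.

Lemma ge0_integral_density (g : T -> \bar R) :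
  measurable_fun setT g -> (forall x, (0 <= g x)%E) ->
  (\int[density_measure du]_x g x = \int[m]_x (g x * (u x)%:E))%E.
Proof.
move=> mg g0.
have dom : density_measure du `<< m.
  apply/null_content_dominatesP => A mA A0; rewrite /density_measure /=.
  by apply: null_set_integral => //; exact: measurable_funTS.
rewrite -(Radon_Nikodym_SigmaFinite.change_of_variables dom)//.
have if_ := Radon_Nikodym_SigmaFinite.f_integrable dom.
apply: ae_eq_integral => //.
- by apply: emeasurable_funM => //; exact: measurable_int if_.
- exact: emeasurable_funM.
apply: ae_eqe_mul2l.
(* [u] and the Radon-Nikodym derivative have the same integrals over measurable sets, hence agree
   almost everywhere. *)
apply: integral_ae_eq => //.
by move=> A _ mA; rewrite -Radon_Nikodym_SigmaFinite.f_integral.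
Qed.

End DensityMeasure.

(** * Translated densities and the law of an observation *)

Section Regression.
Context {R : realType}.
Local Notation leb := (@lebesgue_measure R).

Lemma measurable_shift (c : R) :
  measurable_fun setT ((fun y : R => y - c) : measurableTypeR R -> measurableTypeR R).
Proof.
have := @measurable_funB _ (measurableTypeR R) R setT idfun (cst c).
by apply => //; exact: measurable_id.
Qed.

Lemma ge0_integral_translate (f : measurableTypeR R -> \bar R) (c : R) :
  measurable_fun setT f -> (forall y, (0 <= f y)%E) ->
  (\int[leb]_y f ((y : R) - c)%R = \int[leb]_y f y)%E.
Proof.
move=> mf f0.
pose S : {mfun (measurableTypeR R) >-> (measurableTypeR R)} :=
  HB.pack (fun y : R => y - c)
    (isMeasurableFun.Build _ _ _ _ _ (measurable_shift c)).
transitivity (\int[pushforward leb S]_y f y)%E.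
  by rewrite ge0_integral_pushforward//; exact: measurable_funP.
apply: esym; apply: eq_measure_integral => A mA _.
apply: lebesgue_measure_unique => //.
move=> _ [[a b] _ <-]/=; rewrite /pushforward /=.
rewrite (_ : _ @^-1` _ = `]a + c, b + c]%classic).
  rewrite !lebesgue_measure_itv /= !lte_fin ltrD2r; case: ifP => // _.
  by rewrite -!EFinB; congr (_%:E); ring.
by apply/seteqP; split => y /=; rewrite !in_itv /= ltrBrDr lerBlDr.
Qed.

Lemma is_density_shift (q : R -> R) (c : R) : is_density leb q ->
  is_density leb (fun y : R => q (y - c)).
Proof.
move=> [mq q0 q1]; split => //; first exact: (measurableT_comp mq (measurable_shift c)).
rewrite -q1 -(ge0_integral_translate (fun y => (q y)%:E) c)//.
exact/measurable_EFinP.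
Qed.

Context {d : measure_display} {W : measurableType d} (nu : probability W R).
Local Notation D := (design_measure nu).
Implicit Types (p q : R -> R) (f g : W -> R).

Lemma ge0_integral_design (F : W * measurableTypeR R -> \bar R) :
  measurable_fun setT F -> (forall z, (0 <= F z)%E) ->
  (\int[D]_z F z = \int[nu]_w \int[leb]_y F (w, y))%E.
Proof. by move=> mF F0; rewrite /design_measure fubini_tonelli1. Qed.

Lemma measurable_translate q g : measurable_fun setT q -> measurable_fun setT g ->
  measurable_fun setT (translate q g).
Proof.
move=> mq mg; apply: (measurableT_comp mq).
apply: measurable_funB; first exact: measurable_snd.
exact: (measurableT_comp mg measurable_fst).
Qed.

Lemma is_density_translate q g : is_density leb q -> measurable_fun setT g ->
  is_density D (translate q g).
Proof.
move=> dq mg; have [mq q0 q1] := dq.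
have mt := measurable_translate q g mq mg.
split => //; first by move=> z; exact: q0.
rewrite ge0_integral_design; last 2 first.
- exact/measurable_EFinP.
- by move=> z; rewrite lee_fin; exact: q0.
rewrite -[RHS](integral_probability_cst nu 1); apply: eq_integral => w _.
by have [_ _] := is_density_shift q (g w) dq.
Qed.

Lemma hellinger2E {d' : measure_display} {T : measurableType d'}
    (m : {measure set T -> \bar R}) (u v : T -> R) :
  is_density m u -> is_density m v ->
  (\int[m]_x ((Num.sqrt (u x) - Num.sqrt (v x)) ^+ 2)%:E =
   (2 * hellinger2 m u v)%:E)%E.
Proof.
move=> du dv; rewrite /hellinger2 mulrA mulfV// mul1r /Rintegral fineK//.
exact: integrable_fin_num (integrable_sqrt_sub m u v du dv).
Qed.

Lemma measurable_hellinger2_translate p q f g : is_density leb p -> is_density leb q ->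
  measurable_fun setT f -> measurable_fun setT g ->
  measurable_fun setT
    (fun w => hellinger2 leb (fun y : R => p (y - f w)) (fun y : R => q (y - g w))).
Proof.
move=> dp dq mf mg.
have [mpf _ _] := is_density_translate p f dp mf.
have [mqg _ _] := is_density_translate q g dq mg.
have mF : measurable_fun setT (fun z =>
    ((Num.sqrt (translate p f z) - Num.sqrt (translate q g z)) ^+ 2)%:E).
  apply/measurable_EFinP; apply: measurable_funX.
  by apply: measurable_funB; exact: measurable_sqrt.
have F0 (z : W * measurableTypeR R) :
    (0 <= ((Num.sqrt (translate p f z) - Num.sqrt (translate q g z)) ^+ 2)%:E)%E.
  by rewrite lee_fin sqr_ge0.
have mI := measurable_fun_fubini_tonelli_F (m2 := leb) _ mF F0.
rewrite /hellinger2; apply: measurable_funM => //.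
by apply: (measurableT_comp _ mI); exact: fine_measurable.
Qed.

Lemma hellinger2_translate p q f g : is_density leb p -> is_density leb q ->
  measurable_fun setT f -> measurable_fun setT g ->
  ((hellinger2 D (translate p f) (translate q g))%:E =
   \int[nu]_w (hellinger2 leb (fun y : R => p (y - f w)) (fun y : R => q (y - g w)))%:E)%E.
Proof.
move=> dp dq mf mg.
have dpf := is_density_translate p f dp mf; have dqg := is_density_translate q g dq mg.
have [mpf _ _] := dpf; have [mqg _ _] := dqg.
have mF : measurable_fun setT (fun z =>
    (Num.sqrt (translate p f z) - Num.sqrt (translate q g z)) ^+ 2).
  by apply: measurable_funX; apply: measurable_funB; exact: measurable_sqrt.
have E : ((2 * hellinger2 D (translate p f) (translate q g))%:E =
   \int[nu]_w (2 * hellinger2 leb (fun y : R => p (y - f w)) (fun y : R => q (y - g w)))%:E)%E.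
  rewrite -hellinger2E// ge0_integral_design; first last.
  - by move=> z; rewrite lee_fin sqr_ge0.
  - exact/measurable_EFinP.
  apply: eq_integral => w _.
  exact: (hellinger2E leb _ _ (is_density_shift p (f w) dp) (is_density_shift q (g w) dq)).
have mh := measurable_hellinger2_translate p q f g dp dq mf mg.
move: E; under eq_integral do rewrite EFinM.

rewrite ge0_integralZl_EFin//; last 2 first.
- by move=> w _; rewrite lee_fin hellinger2_ge0.
- exact/measurable_EFinP.
rewrite EFinM => E; apply/eqP; rewrite eq_le.
by rewrite -(@lee_pmul2l _ 2%:E)// -[X in _ && X](@lee_pmul2l _ 2%:E)// E lexx.
Qed.

Lemma hellinger2_shift p q (c : R) : is_density leb p -> is_density leb q ->
  hellinger2 leb (fun y : R => p (y - c)) (fun y : R => q (y - c)) = hellinger2 leb p q.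
Proof.
move=> dp dq; have [mp _ _] := dp; have [mq _ _] := dq.
have mG : measurable_fun setT (fun y => (Num.sqrt (p y) - Num.sqrt (q y)) ^+ 2).
  by apply: measurable_funX; apply: measurable_funB; exact: measurable_sqrt.
have := hellinger2E leb _ _ (is_density_shift p c dp) (is_density_shift q c dq).
rewrite (ge0_integral_translate (fun y => ((Num.sqrt (p y) - Num.sqrt (q y)) ^+ 2)%:E)).
- by rewrite (hellinger2E leb _ _ dp dq) => -[]; lra.
- exact/measurable_EFinP.
- by move=> y; rewrite lee_fin sqr_ge0.
Qed.

Lemma hellinger2_translate_same p q g : is_density leb p -> is_density leb q ->
  measurable_fun setT g ->
  hellinger2 D (translate p g) (translate q g) = hellinger2 leb p q.
Proof.
move=> dp dq mg; apply: EFin_inj; rewrite hellinger2_translate//.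
under eq_integral do rewrite hellinger2_shift//.
exact: integral_probability_cst.
Qed.

Section Law.
Context {dO : measure_display} {Omega : measurableType dO} (P : probability Omega R)
  (p : R -> R) (f : W -> R) {n : nat}
  (X : 'I_n -> {RV P >-> (W * measurableTypeR R)%type}).
Hypotheses (dp : is_density leb p) (mf : measurable_fun setT f).
Hypothesis sample : regression_sample nu p f X.

Lemma ge0_integral_regression (i : 'I_n) (F : W * measurableTypeR R -> \bar R) :
  measurable_fun setT F -> (forall z, (0 <= F z)%E) ->
  (\int[P]_w F (X i w) = \int[D]_z (F z * (translate p f z)%:E))%E.
Proof.
move=> mF F0; have [_ law1 law2 law12] := sample.
have [mp p0 _] := dp.
pose Z (w : Omega) : W * measurableTypeR R := ((X i w).1, (X i w).2 - f (X i w).1).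
have mX : measurable_fun setT (X i) by exact: measurable_funP.
have mX1 : measurable_fun setT (fun w => (X i w).1).
  by apply: (measurableT_comp _ mX); exact: measurable_fst.
have mX2 : measurable_fun setT (fun w => (X i w).2).
  by apply: (measurableT_comp _ mX); exact: measurable_snd.
have mZ : measurable_fun setT Z.
  apply: measurable_fun_pair => //; apply: measurable_funB => //.
  exact: measurableT_comp.
(* [F'] is [F] in the coordinates design and error, in which the law of an observation is a product
   measure. *)
pose F' (z : W * measurableTypeR R) := F (z.1, z.2 + f z.1).
have mF' : measurable_fun setT F'.
  apply: (measurableT_comp mF); apply: measurable_fun_pair; first exact: measurable_fst.
  apply: measurable_funD; first exact: measurable_snd.
  exact: (measurableT_comp mf measurable_fst).
pose S : {mfun Omega >-> (W * measurableTypeR R)%type} :=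
  HB.pack Z (isMeasurableFun.Build _ _ _ _ _ mZ).
transitivity (\int[pushforward P S]_z F' z)%E.
  have -> : (\int[pushforward P S]_z F' z = \int[P]_(w in Z @^-1` setT) (F' \o Z) w)%E.
    by apply: (ge0_integral_pushforward mZ) => // z _; exact: F0.
  by apply: eq_integral => w _; rewrite /F' /= subrK -surjective_pairing.
transitivity (\int[nu \x density_measure leb p dp]_z F' z)%E.
  apply: esym; apply: eq_measure_integral => A mA _.
  apply: product_measure_unique => // A1 A2 mA1 mA2.
  apply: (eq_trans (law12 i A1 A2 mA1 mA2)).
  by congr (_ * _)%E; [exact: law1|exact: law2].
rewrite fubini_tonelli1//; last by move=> z; exact: F0.
rewrite ge0_integral_design; last 2 first.
- apply: emeasurable_funM => //; apply/measurable_EFinP.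
  exact: measurable_translate.
- by move=> z; rewrite mule_ge0// lee_fin; exact: p0.
apply: eq_integral => w _; rewrite /fubini_F.
have mF'w : measurable_fun setT (fun y => F' (w, y)) by exact: measurable_fun_pair2.
rewrite ge0_integral_density//; last by move=> x; exact: F0.
rewrite -(ge0_integral_translate (fun y => (F' (w, y) * (p y)%:E)%E) (f w)).
- by apply: eq_integral => y _; rewrite /F' /= subrK.
- by apply: emeasurable_funM => //; exact/measurable_EFinP.
- by move=> y; apply: mule_ge0; [exact: F0|rewrite lee_fin; exact: p0].
Qed.

Lemma bounded_integral_regression (i : 'I_n) (B : W * measurableTypeR R -> R) (M : R) :
  measurable_fun setT B -> (forall z, `|B z| <= M) ->
  (\int[P]_w (B (X i w))%:E = (Rintegral D setT (fun z => B z * translate p f z))%:E)%E.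
Proof.
move=> mB BM.
have dpf := is_density_translate p f dp mf.
have [mpf pf0 pf1] := dpf.
(* Adding [M] makes the integrand nonnegative; the constant cancels at the end because
   [translate p f] has mass 1. *)
have := ge0_integral_regression i (fun z => (B z + M)%:E).
have iB : P.-integrable setT (EFin \o (fun w => B (X i w))).
  apply: (bounded_integrable P _ M) => //.
  by apply: (measurableT_comp mB); exact: measurable_funP.
have iM : P.-integrable setT (EFin \o cst M) by exact: finite_measure_integrable_cst.
have ipf := is_density_integrable _ _ dpf.
have iBp : D.-integrable setT (EFin \o (fun z => B z * translate p f z)).
  apply: (integrable_dominated _ _ (fun z => M * translate p f z)).
  - exact: measurable_funM.
  - exact: (integrableR_Z D M _ ipf).
  - by move=> z; rewrite normrM (ger0_norm (pf0 z)) ler_wpM2r.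
have iMp : D.-integrable setT (EFin \o (fun z => M * translate p f z)).
  exact: (integrableR_Z D M _ ipf).
have mBM : measurable_fun setT (fun z => (B z + M)%:E).
  by apply/measurable_EFinP; exact: measurable_funD.
have BM0 z : (0 <= (B z + M)%:E)%E.
  by rewrite lee_fin; have /ler_normlP[] := BM z; lra.
move=> /(_ mBM BM0).
have -> : (\int[P]_w (B (X i w) + M)%:E = \int[P]_w (B (X i w))%:E + M%:E)%E.
  by rewrite -[in RHS](integral_probability_cst P M) -integralD.
have -> : (\int[D]_z ((B z + M)%:E * (translate p f z)%:E) =
    (Rintegral D setT (fun z => B z * translate p f z))%:E + M%:E)%E.
  transitivity (\int[D]_z ((B z * translate p f z)%:E + (M * translate p f z)%:E))%E.
    by apply: eq_integral => z _; rewrite -EFinM -EFinD mulrDl.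
  rewrite integralD//; congr (_ + _)%E.
    by rewrite /Rintegral fineK//; exact: integrable_fin_num iBp.
  under eq_integral do rewrite EFinM.
  by rewrite integralZl// pf1 mule1.
by move=> H; rewrite -[LHS](@addeK _ M%:E)// H addeK.
Qed.

End Law.

End Regression.

(** * Deviation of the test over a VC class *)

(** Wherever the mode lies, [q] is monotone on one open half-line from 0, and reflection gives the
    other. Nothing is claimed at 0. *)
Lemma even_unimodal {R : realType} (q : R -> R) : unimodal q -> even_fun q ->
  (forall x y, x <= y -> y < 0 -> q x <= q y) /\
  (forall x y, 0 < x -> x <= y -> q y <= q x).
Proof.
move=> [a [ql qr]] qe; have [a0|a0] := leP a 0.
  have H x y : 0 < x -> x <= y -> q y <= q x.
    by move=> x0; apply: qr; exact: le_lt_trans x0.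
  split => // x y xy y0; rewrite -(qe x) -(qe y); apply: H; first by rewrite oppr_gt0.
  by rewrite lerN2.
have H x y : x <= y -> y < 0 -> q x <= q y.
  by move=> xy y0; apply: ql => //; exact: lt_trans a0.
split => // x y x0 xy; rewrite -(qe x) -(qe y); apply: H; first by rewrite lerN2.
by rewrite oppr_lt0.
Qed.

Section Complexity.
Context {R : realType} {d : measure_display} {W : measurableType d}.
Variables (F : set (W -> R)) (V : nat) (q : R -> R).
Hypotheses (FV : vc_subgraph F V) (q0 : forall y, 0 <= q y) (qu : unimodal q)
  (qe : even_fun q).
Local Notation Z := (W * measurableTypeR R)%type.

Lemma sum_swap_vc (eps : R) (n m K : nat) (gb : W -> R) (g : 'I_m -> W -> R)
    (phi : 'I_m -> Z -> R) (x x' : 'I_n -> Z) :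
  0 < eps <= 2^-1 -> (0 < K)%N -> (forall k, F (g k)) ->
  (forall k z, phi k z = signed_root (translate q gb z) (translate q (g k) z)) ->
  \sum_(s : {ffun 'I_n -> bool}) \big[Order.max/0]_(k < m)
    expR (\sum_(i < n) if s i then swap_exponent eps (phi k (x' i)) (phi k (x i))
                       else swap_exponent eps (phi k (x i)) (phi k (x' i)))
  <= 2 ^+ n * ((\sum_(j < V) 'C(16 * n * K, j))%:R * expR (n%:R * (eps / 8 * K%:R^-1))).
Proof.
move=> eps01 K0 Fg phiE.
have [ql qr] := even_unimodal q qu qe.
pose J := (('I_n + 'I_n) * 'I_(2 * K))%type.
pose z (j : J) : Z := match j.1 with inl i => x i | inr i => x' i end.
(* As [a] grows, [(z j).2 - a] decreases through 0; for a fixed level, [Q j] is therefore unimodal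
   about the response [(z j).2]. *)
pose Q (j : J) (a : R) : bool :=
  -1 + (j.2 : nat)%:R / K%:R < signed_root (translate q gb (z j)) (q ((z j).2 - a)).
have [||pat [patc patP]] := @vc_unimodal_patterns R W F V m J (fun j => (z j).1)
    (fun j => (z j).2) Q g FV Fg.
- move=> j a b ab bz; rewrite /Q => /lt_le_trans; apply; apply: signed_root_homo => //.
  + exact: q0.
  + by apply: qr; rewrite ?subr_gt0// lerD2l lerN2.
- move=> j a b az ab; rewrite /Q => /lt_le_trans; apply; apply: signed_root_homo => //.
  + exact: q0.
  + by apply: ql; rewrite ?subr_lt0// lerD2l lerN2.
have phi1 k w : `|phi k w| <= 1 by rewrite phiE; apply: signed_root_le1; exact: q0.
have close k k' : pat k = pat k' -> forall i : 'I_n + 'I_n,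
    `|phi k (match i with inl i => x i | inr i => x' i end) -
      phi k' (match i with inl i => x i | inr i => x' i end)| <= K%:R^-1.
  by move=> kk' i; apply: same_levels_close => // l; rewrite !phiE; exact: (patP _ _ kk' (i, l)).
apply: le_trans (sum_swap_le eps eps01 (fun k i => phi k (x i))
  (fun k i => phi k (x' i)) pat K%:R^-1 _ _ _) _ => //.
- by move=> k k' kk' i; split; [exact: (close k k' kk' (inl i))|exact: (close k k' kk' (inr i))].
rewrite -mulrA ler_wpM2l ?exprn_ge0// ler_wpM2r ?expR_ge0// ler_nat.
apply: (leq_trans patc).
(* There are [2 * n] observations, [2 * K] levels and four thresholds for each pair. *)
rewrite card_prod card_sum !card_ord.
by rewrite (_ : ((n + n) * (2 * K) * 4 = 16 * n * K)%N)//; lia.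
Qed.

End Complexity.

(** Write r = n / V. Since K is at least r, the discretization costs at most V / 800; since K is at
    most 2 r, the Sauer-Shelah ratio 16 n K / V is at most 2^5 r^2. The exponent V (1 + 5 + 2 log r)
    + V / 800 fits under the factor 7. *)
Lemma log_complexity_le {R : realType} (n V : nat) : (0 < V)%N -> (V <= n)%N ->
  ln ((\sum_(j < V) 'C(16 * n * (n %/ V).+1, j))%:R *
      expR (n%:R * (100^-1 / 8 * (n %/ V).+1%:R^-1))) <=
  7 * (V%:R * (1 + logp (n%:R / V%:R))) :> R.
Proof.
move=> V0 Vn; set K := (n %/ V).+1.
have V0' : (0 : R) < V%:R by rewrite ltr0n.
have n0' : (0 : R) < n%:R by rewrite ltr0n (leq_trans V0).
have K0' : (0 : R) < K%:R by rewrite ltr0n.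
have nVK : n%:R / V%:R <= K%:R :> R.
  by rewrite ler_pdivrMr// -natrM ler_nat ltnW// ltn_ceil.
have KnV : K%:R <= 2 * (n%:R / V%:R) :> R.
  rewrite mulrA ler_pdivlMr// -!natrM ler_nat /K mulSn.
  by rewrite mul2n -addnn leq_add// leq_trunc_div.
set N := (\sum_(j < V) _)%N; set r := n%:R / V%:R.
have r1 : 1 <= r by rewrite ler_pdivlMr// mul1r ler_nat.
have r0 : 0 < r by exact: lt_le_trans r1.
have N0 : (0 : R) < N%:R.
  rewrite ltr0n /N; case: (V) V0 => // V' _.
  by rewrite big_ord_recl bin0.
rewrite lnM ?posrE ?expR_gt0// expRK.
have logE : logp r = ln r by rewrite /logp; apply/max_idPl; exact: ln_ge0.
have L0 : 0 <= ln r by exact: ln_ge0.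
have VM : (V <= 16 * n * K)%N.
  by rewrite (leq_trans Vn)// -mulnA mulnCA leq_pmulr// muln_gt0.
have NE : ln N%:R <= V%:R * (1 + (5 + 2 * ln r)).
  have e0 : 0 < expR 1 * ((16 * n * K)%:R / V%:R) :> R.
    by rewrite mulr_gt0 ?expR_gt0// divr_gt0// ltr0n (leq_trans V0).
  apply: (@le_trans _ _ (ln ((expR 1 * ((16 * n * K)%:R / V%:R)) ^+ V))).
    by rewrite ler_ln ?posrE ?exprn_gt0//; exact: sum_bin_le.
  rewrite lnXn// -[leLHS]mulr_natl ler_wpM2l ?(ltW V0')//.
  have q0 : 0 < (16 * n * K)%:R / V%:R :> R.
    by rewrite divr_gt0// ltr0n (leq_trans V0).
  rewrite lnM ?posrE ?expR_gt0// expRK lerD2l.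
  apply: (@le_trans _ _ (ln (2 ^+ 5 * r ^+ 2))).
    have r5 : 0 < 2 ^+ 5 * r ^+ 2 by rewrite mulr_gt0// exprn_gt0.
    rewrite ler_ln ?posrE// /r !natrM.
    have -> : 16 * n%:R * K%:R / V%:R = 16 * (n%:R / V%:R) * K%:R :> R.
      by field; rewrite gt_eqF.
    rewrite -/r; have -> : 2 ^+ 5 * r ^+ 2 = 16 * r * (2 * r) :> R by ring.
    by rewrite ler_wpM2l// mulr_ge0// ltW.
  rewrite lnM ?posrE ?exprn_gt0// !lnXn//.
  have : ln 2 <= 1 :> R by apply: (@le_trans _ _ (ln (1 + 1))) => //; apply: le_ln1Dx; lra.
  lra.
have E : n%:R * (100^-1 / 8 * K%:R^-1) <= V%:R :> R.
  have : n%:R / K%:R <= V%:R :> R.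
    by rewrite ler_pdivrMr// -ler_pdivrMl// mulrC.
  move=> nKV; apply: (@le_trans _ _ (800^-1 * (n%:R / K%:R))); last by lra.
  rewrite le_eqVlt; apply/orP; left; apply/eqP; field.
  by rewrite gt_eqF.
rewrite logE; have : 0 <= V%:R * ln r by rewrite mulr_ge0// ltW.
lra.
Qed.

(** The empty set is shattered by every nonempty class. *)
Lemma vc_subgraph_gt0 {R : realType} {T : Type} (F : set (T -> R)) (V : nat) :
  F !=set0 -> vc_subgraph F V -> (0 < V)%N.
Proof.
move=> [g Fg] [FV _]; rewrite lt0n; apply/eqP => V0; apply: FV; rewrite V0.
exists set0; first by rewrite II0.
move=> B; rewrite subset0 => ->; exists (subgraph g); first by exists g.
by rewrite set0I.
Qed.

(** * Risk of the selected estimator *)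

Section KeyBound.
Context {R : realType} {d : measure_display} {W : measurableType d}
  (nu : probability W R) {n : nat} (F : set (W -> R)) (V : nat) (q : R -> R)
  (e : nat -> W -> R) (sel : n.-tuple (W * measurableTypeR R)%type -> nat).
Local Notation leb := (@lebesgue_measure R).
Local Notation D := (design_measure nu).
Hypotheses (n0 : (0 < n)%N) (dq : is_density leb q) (qu : unimodal q)
  (qe : even_fun q) (FV : vc_subgraph F V)
  (mF : forall g, F g -> measurable_fun setT g) (Fe : forall k, F (e k)).
Hypothesis dense : [set translate q g | g in F] `<=`
  hellinger_closure D (range (fun k => translate q (e k))).
Hypothesis selP : forall x,
  rho_candidates D x (range (fun k => translate q (e k))) (translate q (e (sel x))).

Context {dO : measure_display} {Omega : measurableType dO} (P : probability Omega R)
  (p : R -> R) (f : W -> R) (X : 'I_n -> {RV P >-> (W * measurableTypeR R)%type}).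
Hypotheses (dp : is_density leb p) (mf : measurable_fun setT f)
  (smp : regression_sample nu p f X).

Local Notation h2 := (hellinger2 D).
Local Notation pf := (translate p f).
Local Notation t := (fun k => translate q (e k)).
Local Notation best := (inf [set h2 pf (translate q g) | g in F]).

Let dpf : is_density D pf. Proof. exact: is_density_translate. Qed.
Let dt k : is_density D (t k). Proof. by apply: is_density_translate => //; exact: mF. Qed.

(** The infimum over [F] need not be attained, and only members of the enumeration are available;
    the loss [eta] on each account is doubled by the squared triangle inequality. *)
Lemma best_approximation (eta : R) : 0 < eta ->
  exists kb, h2 pf (t kb) <= 2 * best + 4 * eta.
Proof.
move=> eta0.
have hinf : has_inf [set h2 pf (translate q g) | g in F].
  split; first by exists (h2 pf (t 0%N)); exists (e 0%N).
  by exists 0 => _ [g _ <-]; exact: hellinger2_ge0.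
have [_ [g Fg <-] gb] := inf_adherent eta0 hinf.
have [dg cl] := dense _ (ex_intro2 _ _ g Fg erefl).
have sqeta : 0 < Num.sqrt eta by rewrite sqrtr_gt0.
have [_ [kb _ <-]] := cl _ sqeta; rewrite hellinger_lt// sqr_sqrtr ?ltW// => gk.
exists kb; apply: (le_trans (hellinger2_triangle D _ _ _ dpf dg (dt kb))).
lra.
Qed.

(** Only [kb] is tied to the unknown law. The index [k] is free, so that the event makes no
    reference to the selected index. *)
Definition bad_event (kb : nat) (u : R) : set Omega :=
  [set w | exists k : nat, u <= 100^-1 / 32 *
    \sum_(i < n) (signed_root (t kb (X i w)) (t k (X i w)) - test_mean D pf (t kb) (t k))].

Let mphi kb k : measurable_fun setT (fun z => signed_root (t kb z) (t k z)).
Proof.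
by apply: measurable_signed_root; [have [] := dt kb|have [] := dt k].
Qed.

Lemma measurable_bad_event kb u : measurable (bad_event kb u).
Proof.
rewrite (_ : bad_event kb u = \bigcup_k [set w | u <= 100^-1 / 32 *
    \sum_(i < n) (signed_root (t kb (X i w)) (t k (X i w)) - test_mean D pf (t kb) (t k))]).
  apply: bigcupT_measurable => k; apply: measurable_ge_set.
  apply: measurable_funM => //; apply: measurable_sum => i.
  apply: measurable_funB => //; apply: (measurableT_comp (mphi kb k)).
  exact: measurable_funP.
by apply/seteqP; split => w [k]; [exists k|move=> _ ?; exists k].
Qed.

Lemma bad_event_probability kb (K : nat) (u : R) : (0 < K)%N ->
  (P (bad_event kb u) <= (expR (- u) *
     ((\sum_(j < V) 'C(16 * n * K, j))%:R * expR (n%:R * (100^-1 / 8 * K%:R^-1))))%:E)%E.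
Proof.
move=> K0; have [indep _ _ _] := smp.
have e01 : 0 < (100^-1 : R) <= 2^-1 by apply/andP; split; lra.
have q0 : forall y, 0 <= q y by have [] := dq.
apply: (@uniform_deviation R _ _ Omega _ P n X indep 100^-1
  (fun k z => signed_root (t kb z) (t k z)) (fun k => test_mean D pf (t kb) (t k))) => //.
- by move=> k z; apply: signed_root_le1; exact: q0.
- move=> k i; have mB := measurable_test D _ _ (dt kb) (dt k).
  rewrite (bounded_integral_regression nu P p f X dp mf smp i _ 2 mB)//.
  by move=> z; apply: signed_root_test_bound; exact: q0.
- move=> m x x'; apply: (sum_swap_vc F V q FV q0 qu qe 100^-1 n m K (e kb) (fun k : 'I_m => e k)
    (fun (k : 'I_m) z => signed_root (t kb z) (t k z))) => //.
Qed.

Lemma good_event_risk kb (u : R) w : 0 <= u -> ~ bad_event kb u w ->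
  h2 pf (t (sel (sample (fun i => X i : Omega -> _) w))) <=
    32 * h2 pf (t kb) + (16 * (3200 * u) + 288) / n%:R.
Proof.
move=> u0 good; set x := sample _ w.
have Sd : range t `<=` is_density D by move=> _ [k _ <-]; exact: dt.
apply: (rho_candidate_risk D n x (range t) pf (t kb) _ (3200 * u) n0 Sd) => //.
move=> _ [k _ <-].
have q0 : forall y, 0 <= q y by have [] := dq.
rewrite rho_testE; [|by move=> y; exact: q0..].
have := test_drift D pf (t kb) (t k) dpf (dt kb) (dt k).
have /negP := contra_not (fun h => ex_intro (fun k => _) k h) good.
rewrite -ltNge.
have -> : \sum_(i < n) signed_root (t kb (tnth x i)) (t k (tnth x i)) =
   \sum_(i < n) (signed_root (t kb (X i w)) (t k (X i w)) - test_mean D pf (t kb) (t k))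
   + n%:R * test_mean D pf (t kb) (t k).
  rewrite sumrB sumr_const card_ord -[_ *+ n]mulr_natl subrK.
  by apply: eq_bigr => i _; rewrite /x /sample tnth_mktuple.
set s := \sum_(i < n) _; set M := test_mean _ _ _ _.
set A := affinity _ _ _ - _; set H := (2 * _ - _).
set c := (Num.sqrt 2)^-1 => su drift.
have c0 : 0 < c by rewrite invr_gt0 sqrtr_gt0.
have c1 : c <= 1.
  rewrite invf_le1 ?sqrtr_gt0// -[X in X <= _]sqrtr1 ler_wsqrtr//; lra.
have n0' : (0 : R) < n%:R by rewrite ltr0n.
(* [3200 = 32 * 100] undoes the scale of the bad event. The factor [c <= 1] may be dropped only when
   [s] is nonnegative. *)
have su' : c * s <= 3200 * u.
  have [s0|s0] := leP 0 s.
    by apply: (@le_trans _ _ s); [rewrite ler_piMl|lra].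
  by apply: (@le_trans _ _ 0); [rewrite mulr_ge0_le0// ltW|lra].
have : n%:R * (2^-1 * A + c * M) <= n%:R * H by rewrite ler_wpM2l// ltW.
have -> : n%:R * (2^-1 * A + c * M) = n%:R / 2 * A + c * (n%:R * M) by field.
lra.
Qed.

(** An exceptional event is produced instead of a probability bound: each conclusion has only to
    hold outside it, and owes its own measurability to the selector. *)
Lemma regression_risk (xi : R) : 0 < xi ->
  exists Bad : set Omega, [/\ measurable Bad, (P Bad <= (expR (- xi))%:E)%E &
    forall w, ~ Bad w ->
      h2 pf (t (sel (sample (fun i => X i : Omega -> _) w))) <=
        500 * 1000 * (best + risk_term n V xi)].
Proof.
move=> xi0.
have n0' : (0 : R) < n%:R by rewrite ltr0n.
have V0 : (0 < V)%N by apply: vc_subgraph_gt0 FV; exists (e 0%N).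
have V0' : (0 : R) < V%:R by rewrite ltr0n.
have best0 : 0 <= best.
  apply: lb_le_inf; first by exists (h2 pf (t 0%N)); exists (e 0%N).
  by move=> _ [g _ <-]; exact: hellinger2_ge0.
pose L : R := 1 + logp (n%:R / V%:R).
have L1 : 1 <= L by rewrite lerDl /logp le_max lexx orbT.
(* For [n < V] the right-hand side exceeds 1, which bounds any squared Hellinger distance. *)
have [nV|Vn] := ltnP n V.
  exists set0; split => //; first by rewrite measure0 lee_fin expR_ge0.
  move=> w _; apply: (le_trans (hellinger2_le1 D _ _ dpf (dt _))).
  have VN : 1 <= V%:R / n%:R :> R by rewrite ler_pdivlMr// mul1r ler_nat ltnW.
  have : 1 <= V%:R / n%:R * L by rewrite -[leLHS]mulr1 ler_pM.
  have : 0 < xi / n%:R by rewrite divr_gt0.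
  rewrite /risk_term -/L; lra.
pose K := (n %/ V).+1.
pose c : R := (\sum_(j < V) 'C(16 * n * K, j))%:R * expR (n%:R * (100^-1 / 8 * K%:R^-1)).
have N1 : (1 : R) <= (\sum_(j < V) 'C(16 * n * K, j))%:R.
  rewrite ler1n; case: (V) V0 => // V' _.
  by rewrite big_ord_recl bin0.
have c1 : 1 <= c.
  rewrite -[leLHS]mulr1 ler_pM// -[leLHS]expR0 ler_expR.
  by rewrite !mulr_ge0// ?invr_ge0.
have c0 : 0 < c by exact: lt_le_trans c1.
have lnc : ln c <= 7 * (V%:R * L) by exact: log_complexity_le.
have lnc0 : 0 <= ln c by exact: ln_ge0.
have ni0 : 0 < n%:R^-1 :> R by rewrite invr_gt0.
have [kb kbP] := best_approximation n%:R^-1 ni0.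
(* With this threshold the bound [expR (- u) * c] is exactly [expR (- xi)]. *)
exists (bad_event kb (xi + ln c)); split.
- exact: measurable_bad_event.
- apply: (le_trans (bad_event_probability kb K _ _)) => //.
  rewrite -/c lee_fin opprD expRD [expR (- ln c)]expRN lnK ?posrE// -mulrA mulVf ?mulr1//.
  by rewrite gt_eqF.
move=> w good; have u0 : 0 <= xi + ln c by rewrite addr_ge0// ltW.
apply: (le_trans (good_event_risk kb _ w u0 good)).
have VL : 1 <= V%:R * L by rewrite -[leLHS]mulr1 ler_pM// ler1n.
(* [16 * 3200 * 7 = 358400], and the constant 288 is absorbed since [V * L >= 1]. In the same way
   the 128 / n coming from [eta = n^-1] fits under the final 500000. *)
have H1 : (16 * (3200 * (xi + ln c)) + 288) / n%:R <=
    (52 * 1000 * xi + 360 * 1000 * (V%:R * L)) / n%:R.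
  by rewrite ler_wpM2r ?ltW//; lra.
have H2 : n%:R^-1 <= V%:R * L / n%:R by rewrite ler_peMl// ltW.
have H3 : (52 * 1000 * xi + 360 * 1000 * (V%:R * L)) / n%:R =
  52 * 1000 * (xi / n%:R) + 360 * 1000 * (V%:R * L / n%:R) by field; rewrite gt_eqF.
have H4 : risk_term n V xi = V%:R * L / n%:R + xi / n%:R.
  by rewrite /risk_term -/L mulrAC.
have H5 : 0 < xi / n%:R by rewrite divr_gt0.
rewrite H4; lra.
Qed.

End KeyBound.

(** * Comparison of the loss with a power of a norm *)

Section OrderBounds.
Context {R : realType}.

(** The maximum with 1 keeps this bound positive whatever [b] is. *)
Definition order_cap (b alpha : R) : R := Num.max 1 ((2 * b) `^ (1 + alpha)).

(** The slope of a linear minorant of the saturating function [Num.min x A^-1] on the interval from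
    0 to [order_cap b alpha]. *)
Definition order_lower (A b alpha : R) : R := Num.min 1 (A * order_cap b alpha)^-1.

Lemma order_cap_ge1 b alpha : 1 <= order_cap b alpha.
Proof. by rewrite /order_cap le_max lexx. Qed.

Lemma order_lower_gt0 A b alpha : 0 < A -> 0 < order_lower A b alpha.
Proof.
move=> A0; rewrite /order_lower lt_min ltr01 invr_gt0 mulr_gt0//.
exact: lt_le_trans (order_cap_ge1 b alpha).
Qed.

Lemma order_cap_ge (b alpha u v : R) : -1 < alpha -> `|u| <= b -> `|v| <= b ->
  `|u - v| `^ (1 + alpha) <= order_cap b alpha.
Proof.
move=> al ub vb; rewrite /order_cap le_max; apply/orP; right.
apply: ge0_ler_powR; rewrite ?nnegrE//; first by lra.
  by rewrite mulr_ge0// (le_trans _ ub).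
by rewrite (le_trans (ler_normB _ _))//; lra.
Qed.

Lemma order_lower_min (A b alpha x : R) : 0 < A -> 0 <= x <= order_cap b alpha ->
  order_lower A b alpha * x <= Num.min x A^-1.
Proof.
move=> A0 /andP[x0 xB]; have B0 := lt_le_trans ltr01 (order_cap_ge1 b alpha).
have c1 : order_lower A b alpha <= 1 by rewrite ge_min lexx.
have c2 : order_lower A b alpha <= (A * order_cap b alpha)^-1.
  by rewrite ge_min lexx orbT.
rewrite le_min ler_piMl//=.
have AB : 0 < A * order_cap b alpha by rewrite mulr_gt0.
apply: (@le_trans _ _ ((A * order_cap b alpha)^-1 * order_cap b alpha)).
  by apply: ler_pM => //; exact/ltW/order_lower_gt0.
by rewrite invfM -mulrA mulVf ?mulr1// gt_eqF.
Qed.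

Context {d : measure_display} {W : measurableType d} (nu : probability W R).

Lemma order_loss_bounds (p : R -> R) (alpha A a b : R) (f g : W -> R) :
  is_density lebesgue_measure p -> has_order p alpha A a ->
  measurable_fun setT f -> measurable_fun setT g ->
  (forall w, `|f w| <= b) -> (forall w, `|g w| <= b) ->
  a * order_lower A b alpha * Lnorm_pow nu (1 + alpha) (fun w => f w - g w)
    <= loss nu p f g <= A * Lnorm_pow nu (1 + alpha) (fun w => f w - g w).
Proof.
move=> dp [/andP[al _] a0 aA ord] mf mg fb gb.
have A0 : 0 < A by exact: lt_le_trans aA.
pose x w := `|f w - g w| `^ (1 + alpha).
have x0 w : 0 <= x w by exact: powR_ge0.
have xB w : x w <= order_cap b alpha by exact: order_cap_ge.
have mx : measurable_fun setT x.
  apply: (measurableT_comp (measurable_powR _)).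
  by apply: measurableT_comp => //; exact: measurable_funB.
have ix : nu.-integrable setT (EFin \o x).
  by apply: (bounded_integrable nu _ (order_cap b alpha)) => // w; rewrite ger0_norm.
have NE : (\int[nu]_w (x w)%:E = (Lnorm_pow nu (1 + alpha) (fun w => f w - g w))%:E)%E.
  rewrite /Lnorm_pow /Rintegral fineK//.
  exact: integrable_fin_num ix.
have HE := hellinger2_translate nu p p f g dp dp mf mg.
have mh := measurable_hellinger2_translate nu p p f g dp dp mf mg.
have ordw w := ord (f w) (g w).
have k0 : 0 <= a * order_lower A b alpha.
  by rewrite mulr_ge0 ?ltW// order_lower_gt0.
rewrite -!lee_fin; apply/andP; split; rewrite /loss HE EFinM -NE.
  rewrite -ge0_integralZl_EFin//; [|by move=> w _; rewrite lee_fin|exact/measurable_EFinP].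
  apply: ge0_le_integral => //.
  - by move=> w _; rewrite mule_ge0 ?lee_fin.
  - by apply: emeasurable_funM => //; exact/measurable_EFinP.
  - exact/measurable_EFinP.
  move=> w _; rewrite -EFinM lee_fin; have /andP[lo _] := ordw w.
  apply: le_trans lo; rewrite -mulrA ler_wpM2l ?(ltW a0)//.
  by apply: order_lower_min => //; rewrite x0 xB.
rewrite -ge0_integralZl_EFin//; last 3 first.
- by move=> w _; rewrite lee_fin.
- exact/measurable_EFinP.
- exact: ltW.
apply: ge0_le_integral => //.
- by move=> w _; rewrite lee_fin hellinger2_ge0.
- exact/measurable_EFinP.
- by apply: emeasurable_funM => //; exact/measurable_EFinP.
move=> w _; rewrite -EFinM lee_fin; have /andP[_ up] := ordw w.
by apply: (le_trans up); rewrite ler_wpM2l ?(ltW A0)// ge_min lexx.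
Qed.

End OrderBounds.

(** * From pointwise bounds to events *)

Lemma sup_norm_le {R : realType} {T : Type} (g : T -> R) (b : R) :
  (sup_norm g <= b%:E)%E -> forall w, `|g w| <= b.
Proof.
move=> gb w; rewrite -lee_fin; apply: le_trans gb.
by apply: ereal_sup_ubound; exists w.
Qed.

Lemma inf_affine_le {R : realType} {I : Type} (F : set I) (phi psi : I -> R) (a c : R) :
  F !=set0 -> 0 < c -> (forall g, F g -> 0 <= phi g) ->
  (forall g, F g -> phi g <= a + c * psi g) ->
  inf [set phi g | g in F] <= a + c * inf [set psi g | g in F].
Proof.
move=> [g0 Fg0] c0 phi0 phipsi.
rewrite -lerBlDl -ler_pdivrMl//; apply: lb_le_inf; first by exists (psi g0); exists g0.
move=> _ [g Fg <-]; rewrite ler_pdivrMl// lerBlDl.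
apply: le_trans (phipsi g Fg); apply: ge_inf; last by exists g.
by exists 0 => _ [g' Fg' <-]; exact: phi0.
Qed.

(** The event depends on the sample through an index only, so it is measurable for an arbitrary
    predicate [Q]; its complement lies inside [Bad]. *)
Lemma prob_at_least_selector {R : realType} {dO dE : measure_display}
    {Omega : measurableType dO} {E : measurableType dE} (P : probability Omega R)
    (x : Omega -> E) (sel : E -> nat) (Q : nat -> Prop) (Bad : set Omega) (c : R) :
  measurable_fun setT x -> (forall B : set nat, measurable (sel @^-1` B)) ->
  measurable Bad -> (P Bad <= c%:E)%E ->
  (forall w, ~ Bad w -> Q (sel (x w))) ->
  prob_at_least P [set w | Q (sel (x w))] (1 - c).
Proof.
move=> mx msel mBad PBad good.
have mQ : measurable [set w | Q (sel (x w))].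
  have := mx measurableT _ (msel Q); rewrite setTI.
  by congr measurable; apply/seteqP; split.
split => //; have -> : [set w | Q (sel (x w))] = ~` ~` [set w | Q (sel (x w))].
  by rewrite setCK.
rewrite probability_setC; last exact: measurableC.
rewrite EFinB leeB//; apply: le_trans PBad; apply: le_measure; rewrite ?inE//.
  exact: measurableC.
by move=> w /= nQ; apply: contrapT => /good.
Qed.

Theorem theorem28 (R : realType) :
  exists2 C : R, 0 < C &
  exists2 C' : R -> R -> R -> R -> R, (forall A a b alpha, 0 < C' A a b alpha) &
  forall (d : measure_display) (W : measurableType d) (nu : probability W R)
    (n : nat) (calF : set (W -> R)) (q : R -> R) (F : set (W -> R)) (V : nat),
  (3 <= n)%N ->
  (forall g, calF g -> measurable_fun setT g) ->
  is_density lebesgue_measure q -> unimodal q -> even_fun q ->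
  F `<=` calF ->
  is_model (design_measure nu) [set translate q g | g in F] ->
  vc_subgraph F V ->
  exists (S : set (W * measurableTypeR R -> R)) (fhat : n.-tuple (W * measurableTypeR R) -> W -> R),
  [/\ countable_dense_subset (design_measure nu) S [set translate q g | g in F],
      is_rho_estimator (design_measure nu) S (fun x => translate q (fhat x)),
      (forall x, F (fhat x)) &
  forall (p : R -> R) (f : W -> R)
    (dO : measure_display) (Omega : measurableType dO)
    (P : probability Omega R) (X : 'I_n -> {RV P >-> (W * measurableTypeR R)%type}),
  is_density lebesgue_measure p ->
  calF f ->
  regression_sample nu p f X ->
  let h2 := hellinger2 (design_measure nu) in
  let fh omega := fhat (sample (fun i => X i : Omega -> W * measurableTypeR R) omega) in
  [/\ forall xi, 0 < xi ->
        prob_at_least P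
          [set omega |
            C * h2 (translate p f) (translate q (fh omega))
            <= inf [set h2 (translate p f) (translate q g) | g in F]
               + risk_term n V xi
            <= 2 * hellinger2 lebesgue_measure p q
               + 2 * inf [set h2 (translate p f) (translate p g) | g in F]
               + risk_term n V xi]
          (1 - expR (- xi)),
      p = q ->
      forall xi, 0 < xi ->
        prob_at_least P
          [set omega |
            C * loss nu p f (fh omega)
            <= inf [set loss nu p f g | g in F] + risk_term n V xi]
          (1 - expR (- xi)) &
      p = q ->
      forall alpha A a b : R,
      has_order p alpha A a ->
      (maxe (ereal_sup [set sup_norm g | g in F]) (sup_norm f) <= b%:E)%E ->
      forall xi, 0 < xi ->
        prob_at_least P
          [set omega |
            C' A a b alpha
            * Lnorm_pow nu (1 + alpha) (fun w => f w - fh omega w)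
            <= inf [set Lnorm_pow nu (1 + alpha) (fun w => f w - g w) | g in F]
               + risk_term n V xi]
          (1 - expR (- xi))]].
Proof.
have C0 : 0 < (500 * 1000)^-1 :> R by rewrite invr_gt0; lra.
exists (500 * 1000)^-1 => //; set C := (500 * 1000)^-1 in C0 *.
(* The default 1 keeps [C'] positive for arguments that cannot be the constants of an order. The
   divisor comes from the upper bound of the loss. *)
pose C' (A a b alpha : R) : R := if (0 < a) && (0 < A) then
  C * (a * order_lower A b alpha) / Num.max 1 A else 1.
have max1 (A : R) : 0 < Num.max 1 A by rewrite lt_max ltr01.
exists C' => [A a b alpha|].
  rewrite /C'; case: ifP => // /andP[a0 A0].
  by rewrite divr_gt0// mulr_gt0// mulr_gt0// order_lower_gt0.
move=> d W nu n calF q F V n3 mcalF dq qu qe FcalF [[_ [g0 Fg0 _]] [A Adense]] FV.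
have n0 : (0 < n)%N by exact: leq_trans n3.
have mF g : F g -> measurable_fun setT g by move=> /FcalF/mcalF.
have Fne : F !=set0 by exists g0.
have [S Sdense Sid] := identifiable_dense (design_measure nu) _ _ Adense.
have [cS SF FS] := Sdense.
have Sd : S `<=` is_density (design_measure nu) by move=> t /SF/FS[].
have S0 : S !=set0.
  have [_ /(_ 1 ltr01)[t St _]] := FS _ (ex_intro2 _ _ g0 Fg0 erefl).
  by exists t.
have [e' e'S] := countable_enumeration S cS S0.
(* A member of [S] determines only a translated density; a regression function in [F] is chosen once
   and for all for each index. *)
have [e eP] : {e : nat -> W -> R & forall k, F (e k) /\ translate q (e k) = e' k}.
  suff H k : {g : W -> R | F g /\ translate q g = e' k}.
    by exists (fun k => sval (H k)) => k; exact: (svalP (H k)).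
  apply: cid; have Sk : S (e' k) by rewrite -e'S; exists k.
  by have [g Fg gk] := SF _ Sk; exists g.
have Fe k : F (e k) by have [] := eP k.
have SE : range (fun k => translate q (e k)) = S.
  have eE : (fun k => translate q (e k)) = e' by apply/funext => k; have [] := eP k.
  by rewrite eE.
have ed k : is_density (design_measure nu) (translate q (e k)).
  by apply: Sd; rewrite -SE; exists k.
have [sel [selP msel]] := rho_selector (design_measure nu) n (fun k => translate q (e k)) ed.
exists S; exists (fun x => e (sel x)); split => //.
  (* Preimages of arbitrary sets, in particular of Hellinger open ones, are preimages of sets of
     indices. *)
  split => //; first by move=> O _; exact: (msel [set k | O (translate q (e k))]).
  move=> x.
  split => // eps eps0; exists (translate q (e (sel x))); first by rewrite -SE.
  by rewrite /hellinger hellinger2_refl sqrtr0.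
move=> p f dO Omega P X dp /mcalF mf smp h2 fh.
have dense : [set translate q g | g in F] `<=`
    hellinger_closure (design_measure nu) (range (fun k => translate q (e k))).
  by rewrite SE.
have mX := measurable_sample P X.
have risk xi : 0 < xi -> exists Bad : set Omega,
    [/\ measurable Bad, (P Bad <= (expR (- xi))%:E)%E &
      forall w, ~ Bad w -> C * h2 (translate p f) (translate q (fh w)) <=
        inf [set h2 (translate p f) (translate q g) | g in F] + risk_term n V xi].
  move=> xi0; have [Bad [mBad PBad good]] := regression_risk nu F V q e sel n0 dq qu qe
    FV mF Fe dense selP P p f X dp mf smp xi xi0.
  exists Bad; split => // w /good H.
  by rewrite /C ler_pdivrMl; [exact: H|lra].
have h2g (g : W -> R) : F g -> is_density (design_measure nu) (translate p g).
  by move=> /mF mg; exact: is_density_translate.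
split.
- move=> xi xi0; have [Bad [mBad PBad good]] := risk xi xi0.
  apply: (prob_at_least_selector P _ sel (fun k =>
    C * h2 (translate p f) (translate q (e k)) <=
    inf [set h2 (translate p f) (translate q g) | g in F] + risk_term n V xi <=
    2 * hellinger2 lebesgue_measure p q
      + 2 * inf [set h2 (translate p f) (translate p g) | g in F]
      + risk_term n V xi) Bad) => //.
  move=> w /good H; apply/andP; split; first exact: H.
  rewrite lerD2r; apply: inf_affine_le => //; first by move=> g _; exact: hellinger2_ge0.
  (* The intermediate density is [translate p g], whose distance to [translate q g] is that of [p]
     to [q]. *)
  move=> g Fg; rewrite -(hellinger2_translate_same nu p q g dp dq (mF g Fg)) addrC.
  apply: hellinger2_triangle; [|exact: h2g|].
    exact: is_density_translate.
  by apply: is_density_translate => //; exact: mF.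
- move=> pq xi xi0; have [Bad [mBad PBad good]] := risk xi xi0; subst q.
  exact: (prob_at_least_selector P _ sel (fun k =>
    C * loss nu p f (e k) <=
    inf [set loss nu p f g | g in F] + risk_term n V xi) Bad).
move=> pq alpha Ap a b ord; rewrite ge_max => /andP[Fb fb] xi xi0.
have [Bad [mBad PBad good]] := risk xi xi0; subst q.
have fb' := sup_norm_le f b fb.
have gb g : F g -> forall w, `|g w| <= b.
  move=> Fg; apply: sup_norm_le; apply: le_trans Fb.
  by apply: ereal_sup_ubound; exists g.
have [_ a0 aA _] := ord; have A0 : 0 < Ap by exact: lt_le_trans aA.
have bounds g (Fg : F g) := order_loss_bounds nu p alpha Ap a b f g dp ord mf (mF g Fg)
  fb' (gb g Fg).
apply: (prob_at_least_selector P _ sel (fun k => C' Ap a b alpha *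
  Lnorm_pow nu (1 + alpha) (fun w => f w - e k w) <=
  inf [set Lnorm_pow nu (1 + alpha) (fun w => f w - g w) | g in F]
    + risk_term n V xi) Bad) => //.
move=> w /good H; rewrite /C' a0 A0 /=.
rewrite mulrAC ler_pdivrMr// -mulrA.
set k := sel _; have /andP[lo _] := bounds (e k) (Fe k).
apply: (@le_trans _ _ (C * loss nu p f (e k))); first by rewrite ler_wpM2l// ltW.
apply: (le_trans H).
have Lge0 g : 0 <= Lnorm_pow nu (1 + alpha) (fun w => f w - g w).
  by apply: Rintegral_ge0 => v _; exact: powR_ge0.
(* The loss costs a factor [Ap]; taking the maximum with 1 lets the same divisor cover the risk
   term. *)
have infle : inf [set loss nu p f g | g in F] <= Num.max 1 Ap *
    inf [set Lnorm_pow nu (1 + alpha) (fun w => f w - g w) | g in F].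
  rewrite -[leRHS]add0r; apply: inf_affine_le => //.
    by move=> g _; exact: hellinger2_ge0.
  move=> g Fg; rewrite add0r; have /andP[_ up] := bounds g Fg.
  by apply: (le_trans up); rewrite ler_wpM2r// le_max lexx orbT.
have r0 : 0 <= risk_term n V xi.
  have L0 : 0 <= 1 + logp (n%:R / V%:R) :> R.
    by rewrite addr_ge0// /logp le_max lexx orbT.
  by rewrite /risk_term addr_ge0 ?divr_ge0 ?(ltW xi0)// mulr_ge0// divr_ge0.
have max_ge1 : 1 <= Num.max 1 Ap by rewrite le_max lexx.
rewrite mulrDl [X in _ <= X + _]mulrC lerD//.
by rewrite ler_peMr.
Qed.
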